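(* Let $(X,d)$ be a metric space with bounded geometry. (1) If $(X,d)$ is recurrent, then the action of $\bigoplus_X \mathbb{Z}/2\mathbb{Z} \rtimes W(X)$ on $\bigoplus_X \mathbb{Z}/2\mathbb{Z}$ is amenable. This includes the cases $X=\mathbb{Z}$ and $X=\mathbb{Z}^2$, and more generally every metric space $(X,d)$ with bounded geometry that embeds coarsely in $\mathbb{Z}^2$ (that is, such spaces are recurrent, and so the conclusion holds for them). (2) If $X$ contains a Lipschitz and injective image of the infinite binary tree (that is, there is an injective Lipschitz map from the vertex set of the infinite binary tree, with its graph distance, to $X$), then the action of $\bigoplus_X \mathbb{Z}/2\mathbb{Z} \rtimes W(X)$ on $\bigoplus_X \mathbb{Z}/2\mathbb{Z}$ is not amenable.
   Context: All metric spaces are discrete. A metric space $X$ has bounded geometry if for every $R>0$ the balls of radius $R$ have bounded cardinality, i.e. $\sup_{x\in X}|B(x,R)|<\infty$, where $B(x,R)=\{y\in X: d(x,y)\le R\}$. The wobbling group $W(X)$ is the group (under composition) of all bijections $g:X\to X$ with $|g|_w:=\sup_{x\in X} d(x,g(x))<\infty$. A mean on a set $Y$ is a linear functional $\mu$ on $\ell_\infty(Y)$ that is unital ($\mu(1)=1$) and satisfies $\|\mu\|=1$. An action of a group $G$ on a set $Y$ is amenable if there is a $G$-invariant mean on $Y$. $\bigoplus_X\mathbb{Z}/2\mathbb{Z}$ is the group of finitely supported functions $X\to\mathbb{Z}/2\mathbb{Z}$. It acts on itself by translation, and $W(X)$ acts on it by permuting the basis indexed by $X$; together these give the action of the semidirect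 product $\bigoplus_X \mathbb{Z}/2\mathbb{Z}\rtimes W(X)$ on $\bigoplus_X\mathbb{Z}/2\mathbb{Z}$: $(a,g)\cdot b=a+g\cdot b$. Fix $x_0\in X$. $(X,d)$ is called transient if there is $R>0$ such that the random walk starting at $x_0$ and jumping from a point $x$ uniformly to $B(x,R)$ is transient; otherwise $(X,d)$ is called recurrent. (This does not depend on $x_0$.) A map $q:(X,d_X)\to(Y,d_Y)$ between metric spaces is a coarse embedding if there exist nondecreasing functions $\varphi_+,\varphi_-:[0,\infty)\to\mathbb{R}$ with $\lim_{t\to\infty}\varphi_-(t)=\infty$ and $\varphi_-(d_X(x,x'))\le d_Y(q(x),q(x'))\le\varphi_+(d_X(x,x'))$ for all $x,x'\in X$. $\mathbb{Z}$ and $\mathbb{Z}^2$ carry word metrics with respect to finite generating sets. *)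

(* Defs.v *)
From HB Require Import structures.
From mathcomp Require Import all_boot all_order all_algebra.
From mathcomp Require Import finmap.
From mathcomp Require Import all_classical all_reals all_analysis.

Set Implicit Arguments.
Unset Strict Implicit.
Unset Printing Implicit Defensive.

Import Order.TTheory GRing.Theory Num.Theory.
Import numFieldNormedType.Exports.

Local Open Scope classical_set_scope.
Local Open Scope ring_scope.

Section Metric.
Context {R : realType}.
Implicit Types X Y : metricType R.

Definition cball X (x : X) (r : R) : set X := [set y | mdist x y <= r].

Definition bounded_geometry X : Prop :=
  forall r : R, 0 < r -> exists N : nat, forall x : X, (cball x r #<= `I_N)%card.

Definition coarse_embedding X Y (q : X -> Y) : Prop :=
  exists phip phim : R -> R,
    [/\ forall s t, 0 <= s -> s <= t -> phip s <= phip t,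
        forall s t, 0 <= s -> s <= t -> phim s <= phim t,
        phim t @[t --> +oo] --> +oo &
        forall x x' : X,
          phim (mdist x x') <= mdist (q x) (q x') <= phip (mdist x x')].

Definition lipschitz_map X Y (f : X -> Y) : Prop :=
  exists L : R, forall x x' : X, mdist (f x) (f x') <= L * mdist x x'.

End Metric.

Section RandomWalk.
Context {R : realType} {X : metricType R}.

(* Only meaningful when balls are finite, since fset_set of an infinite set
   is empty. *)
Definition step_prob (r : R) (x y : X) : R :=
  if mdist x y <= r then (#|` fset_set (cball x r) |)%:R^-1 else 0.

Fixpoint walk_prob (r : R) (x : X) (w : seq X) : R :=
  if w is y :: w' then step_prob r x y * walk_prob r y w' else 1.

(* The event "X_n = x0 for some n >= 1" is the disjoint union, over the finite
   words w avoiding x0, of the cylinders (X_1, ..., X_n) = rcons w x0, where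
   n = size w + 1; the sum below is therefore its probability. *)
Definition return_prob (r : R) (x0 : X) : \bar R :=
  \esum_(w in [set w : seq X | x0 \notin w]) (walk_prob r x0 (rcons w x0))%:E.

Definition transient (x0 : X) : Prop :=
  exists2 r : R, 0 < r & (return_prob r x0 < 1)%E.

Definition recurrent (x0 : X) : Prop := ~ transient x0.

End RandomWalk.

Record cgraph := CGraph {
  vertex :> choiceType;
  adj : rel vertex;
  adj_sym : symmetric adj;
  adj_conn : forall x y, exists2 p, path adj x p & last x p = y
}.

Section GraphMetric.
Variables (R : realType) (G : cgraph).
Implicit Types x y z : G.

Lemma gdist_ex x y : exists n, `[< exists p,
  [/\ path (@adj G) x p, last x p = y & size p = n] >].
Proof.
by have [p Hp <-] := adj_conn x y; exists (size p); apply/asboolP; exists p.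
Qed.

Definition gdist x y : nat := ex_minn (gdist_ex x y).

Lemma gdistP x y : exists p,
  [/\ path (@adj G) x p, last x p = y & size p = gdist x y].
Proof. by rewrite /gdist; case: ex_minnP => n /asboolP. Qed.

Lemma gdist_min x p : path (@adj G) x p -> (gdist x (last x p) <= size p)%N.
Proof.
move=> xp; rewrite /gdist; case: ex_minnP => n _; apply.
by apply/asboolP; exists p.
Qed.

Lemma gdistxx x : gdist x x = 0%N.
Proof. by apply/eqP; rewrite -leqn0 (@gdist_min x [::]). Qed.

Lemma gdist_eq0 x y : gdist x y = 0%N -> x = y.
Proof. by have [p [_ <- <-]] := gdistP x y; move/size0nil ->. Qed.

Lemma gdist_sym_le x y : (gdist y x <= gdist x y)%N.
Proof.
have [p [xp <- <-]] := gdistP x y.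
rewrite -(size_belast x p) -size_rev.
have -> : gdist (last x p) x =
    gdist (last x p) (last (last x p) (rev (belast x p))).
  by case: p {xp} => //= z p; rewrite rev_cons last_rcons.
by apply: gdist_min; rewrite rev_path (eq_path (e' := @adj G)) // => u v;
  exact: adj_sym.
Qed.

Lemma gdist_sym x y : gdist x y = gdist y x.
Proof. by apply/eqP; rewrite eqn_leq !gdist_sym_le. Qed.

Lemma gdist_triangle y x z : (gdist x z <= gdist x y + gdist y z)%N.
Proof.
have [p [xp xpy <-]] := gdistP x y; have [q [yq <- <-]] := gdistP y z.
rewrite -size_cat -xpy -last_cat; apply: gdist_min.
by rewrite cat_path xp xpy.
Qed.

(* R is a phantom argument, for the inference of the metricType R structure. *)
Definition graph_space_of (_ : phant R) : Type := vertex G.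
Local Notation graph_space := (graph_space_of (Phant R)).

HB.instance Definition _ := Choice.on graph_space.

Definition graph_mdist (x y : graph_space) : R := (gdist x y)%:R.

Lemma graph_mdistxx x : graph_mdist x x = 0.
Proof. by rewrite /graph_mdist gdistxx. Qed.

Lemma graph_mdist_eq0 x y : graph_mdist x y = 0 -> x = y.
Proof. by move/eqP; rewrite pnatr_eq0 => /eqP/gdist_eq0. Qed.

Lemma graph_mdist_sym x y : graph_mdist x y = graph_mdist y x.
Proof. by rewrite /graph_mdist gdist_sym. Qed.

Lemma graph_mdist_triangle y x z :
  graph_mdist x z <= graph_mdist x y + graph_mdist y z.
Proof. by rewrite -natrD ler_nat gdist_triangle. Qed.

HB.instance Definition _ := @isMetric.Build R graph_space graph_mdist
  graph_mdistxx graph_mdist_eq0 graph_mdist_sym graph_mdist_triangle.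

End GraphMetric.

Notation graph_space R G := (@graph_space_of R G (Phant R)).

Section Cayley.
Variable V : zmodType.

Definition generates (S : seq V) : Prop :=
  forall P : {pred V}, zmod_closed P -> {subset S <= P} -> forall x, x \in P.

Definition cayley_adj (S : seq V) : rel V :=
  fun x y => (y - x \in S) || (x - y \in S).

Lemma cayley_sym S : symmetric (cayley_adj S).
Proof. by move=> x y; rewrite /cayley_adj orbC. Qed.

Lemma cayley_conn S : generates S ->
  forall x y, exists2 p, path (cayley_adj S) x p & last x p = y.
Proof.
move=> gS.
pose P : {pred V} := [pred v | `[< forall x,
  exists2 p, path (cayley_adj S) x p & last x p = x + v >]].
suff PT : forall v, v \in P.
  move=> x y; have /asboolP/(_ x)[p xp pE] := PT (y - x).
  by exists p; rewrite // pE addrC subrK.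
apply: (gS P) => [|s sS]; last first.
  apply/asboolP => x; exists [:: x + s] => //=.
  by rewrite /cayley_adj addrC addKr sS.
split=> [|u v /asboolP Pu /asboolP Pv]; apply/asboolP => x.
  by exists [::]; rewrite //= addr0.
have [z zE] : exists z, z = x + u - v by exists (x + u - v).
have [p xp pE] := Pu x; have [q zq qE] := Pv z.
have {}qE : last z q = x + u by rewrite qE zE subrK.
exists (p ++ rev (belast z q)).
  rewrite cat_path xp pE /= -qE rev_path.
  by rewrite (eq_path (e' := cayley_adj S)) // => ? ?; exact: cayley_sym.
rewrite last_cat pE addrA -zE -qE.
by case: q zq qE => [|y q] _ //= _; rewrite rev_cons last_rcons.
Qed.

Definition cayley_graph (S : seq V) (gS : generates S) : cgraph :=
  CGraph (@cayley_sym S) (cayley_conn gS).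

(* Distances in the Cayley graph are word lengths. *)
Definition word_space (R : realType) (S : seq V) (gS : generates S) :
  metricType R := graph_space R (cayley_graph gS).

End Cayley.

(* The root is [::] and the children of u are true :: u and false :: u. *)
Definition tree_adj : rel (seq bool) :=
  fun u v => [exists b, v == b :: u] || [exists b, u == b :: v].

Lemma tree_sym : symmetric tree_adj.
Proof. by move=> u v; rewrite /tree_adj orbC. Qed.

Lemma tree_conn u v : exists2 p, path tree_adj u p & last u p = v.
Proof.
have up w : exists2 p, path tree_adj w p & last w p = [::].
  elim: w => [|b w [p wp pE]]; first by exists [::].
  exists (w :: p) => //=; rewrite wp andbT /tree_adj.
  by apply/orP; right; apply/existsP; exists b.
have [p upath pE] := up u; have [q vq qE] := up v.
exists (p ++ rev (belast v q)).
  rewrite cat_path upath pE /= -qE rev_path.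
  by rewrite (eq_path (e' := tree_adj)) // => ? ?; exact: tree_sym.
by rewrite last_cat pE; case: q vq qE => [|z q] _ /= qE;
  rewrite ?rev_cons ?last_rcons.
Qed.

Definition binary_tree : cgraph := CGraph tree_sym tree_conn.

Record action (G : groupType) (Y : Type) := Action {
  act :> G -> Y -> Y;
  act1 : forall y, act 1%g y = y;
  actM : forall g h y, act (g * h)%g y = act g (act h y)
}.

Section Linfty.
Variables (R : realType) (Y : Type).

Definition bounded_pred : {pred (Y -> R^o)} :=
  [pred f | `[< exists M : R, forall y, `|f y| <= M >]].

Lemma bounded_submod : submod_closed bounded_pred.
Proof.
split=> [|a f g /asboolP[M fM] /asboolP[N gN]]; apply/asboolP.
  by exists 0 => y; rewrite normr0.
exists (`|a| * M + N) => y; rewrite (le_trans (ler_normD _ _)) // lerD //.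
by rewrite normrM ler_wpM2l.
Qed.

HB.instance Definition _ :=
  GRing.isSubmodClosed.Build R (Y -> R^o) bounded_pred bounded_submod.

Record linfty := Linfty {
  linfty_fun :> Y -> R^o;
  linfty_bounded : linfty_fun \in bounded_pred
}.

HB.instance Definition _ := [isSub for linfty_fun].
HB.instance Definition _ := [Choice of linfty by <:].
HB.instance Definition _ := [SubChoice_isSubLmodule of linfty by <:].

Lemma linfty_one_subproof : (fun=> 1) \in bounded_pred.
Proof. by apply/asboolP; exists 1 => y; rewrite normr1. Qed.

Definition linfty_one : linfty := Linfty linfty_one_subproof.

Lemma linfty_comp_subproof (f : linfty) (h : Y -> Y) :
  (fun y => f (h y)) \in bounded_pred.
Proof.
by case: f => f /= /asboolP[M fM]; apply/asboolP; exists M => y; exact: fM.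
Qed.

Definition linfty_comp (f : linfty) (h : Y -> Y) : linfty :=
  Linfty (linfty_comp_subproof f h).

Definition linfty_norm (f : linfty) : \bar R :=
  ereal_sup [set (`|f y| : R)%:E | y in [set: Y]].

Definition dual_norm (mu : linfty -> R^o) : \bar R :=
  ereal_sup [set (`|mu f| : R)%:E | f in [set f | (linfty_norm f <= 1)%E]].

Definition is_mean (mu : {linear linfty -> R^o}) : Prop :=
  mu linfty_one = 1 /\ dual_norm mu = 1%E.

Definition amenable_action (G : groupType) (a : action G Y) : Prop :=
  exists2 mu : {linear linfty -> R^o}, is_mean mu &
    forall (g : G) (f : linfty), mu (linfty_comp f (a g)) = mu f.

End Linfty.

Section Wobbling.
Context {R : realType} (X : metricType R).

Definition wnorm (g : X -> X) : \bar R :=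
  ereal_sup [set (mdist x (g x))%:E | x in [set: X]].

Lemma wnormP (g : X -> X) :
  (wnorm g < +oo)%E <-> exists C : R, forall x, mdist x (g x) <= C.
Proof.
split=> [gfin|[C gC]]; last first.
  apply: (@le_lt_trans _ _ C%:E); last exact: ltry.
  by apply: ge_ereal_sup => _ [x _ <-]; rewrite lee_fin.
have [[x0]|X0] := pselect (inhabited X); last first.
  by exists 0 => x; case: X0.
have ub x : ((mdist x (g x))%:E <= wnorm g)%E.
  by apply: ereal_sup_ubound; exists x.
exists (fine (wnorm g)) => x; rewrite -lee_fin fineK //.
rewrite fin_numElt gfin andbT (lt_le_trans _ (ub x0)) // ltNyr //.
Qed.

(* A bijection is stored with its (unique) two-sided inverse. *)
Record wobbling := Wobbling {
  wfun :> X -> X;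
  winv : X -> X;
  wfunK : cancel wfun winv;
  winvK : cancel winv wfun;
  wfun_fin : (wnorm wfun < +oo)%E
}.

Lemma wobbling_eq (g h : wobbling) : wfun g =1 wfun h -> g = h.
Proof.
case: g h => [g g' gK g'K gf] [h h' hK h'K hf] /= /funext gh.
rewrite -gh in hK h'K hf *.
have g'h' : g' = h' by apply/funext => x; rewrite -{1}(h'K x) gK.
rewrite -g'h' in hK h'K *.
by congr Wobbling; exact: Prop_irrelevance.
Qed.

HB.instance Definition _ := gen_eqMixin wobbling.
HB.instance Definition _ := gen_choiceMixin wobbling.

Lemma wone_fin : (wnorm id < +oo)%E.
Proof. by apply/wnormP; exists 0 => x; rewrite mdistxx. Qed.

Definition wone := Wobbling (fun=> erefl) (fun=> erefl) wone_fin.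

Lemma wmul_fin (g h : wobbling) : (wnorm (g \o h) < +oo)%E.
Proof.
have /wnormP[C gC] := wfun_fin g; have /wnormP[D hD] := wfun_fin h.
apply/wnormP; exists (D + C) => x.
by rewrite (le_trans (metric_triangle _ (h x) _)) // lerD //=.
Qed.

Definition wmul (g h : wobbling) := Wobbling
  (can_comp (wfunK g) (wfunK h)) (can_comp (winvK h) (winvK g)) (wmul_fin g h).

Lemma winv_fin (g : wobbling) : (wnorm (winv g) < +oo)%E.
Proof.
have /wnormP[C gC] := wfun_fin g; apply/wnormP; exists C => x.
by rewrite metric_sym -{2}(winvK g x).
Qed.

Definition wopp (g : wobbling) := Wobbling (winvK g) (wfunK g) (winv_fin g).

Lemma wmulA : associative wmul.
Proof. by move=> f g h; apply: wobbling_eq. Qed.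
Lemma wmul1 : left_id wone wmul.
Proof. by move=> f; apply: wobbling_eq. Qed.
Lemma wmulr1 : right_id wone wmul.
Proof. by move=> f; apply: wobbling_eq. Qed.
Lemma wmulV : left_inverse wone wopp wmul.
Proof. by move=> f; apply: wobbling_eq => x /=; rewrite wfunK. Qed.
Lemma wmulrV : right_inverse wone wopp wmul.
Proof. by move=> f; apply: wobbling_eq => x /=; rewrite winvK. Qed.

HB.instance Definition _ :=
  isGroup.Build wobbling wmulA wmul1 wmulr1 wmulV wmulrV.

End Wobbling.

Section DirectSum.
Variable X : Type.

Definition finsupp_pred : {pred (X -> 'Z_2)} :=
  [pred a | `[< finite_set [set x | a x != 0] >]].

Lemma finsupp_zmod : zmod_closed finsupp_pred.
Proof.
split=> [|a b /asboolP fa /asboolP fb]; apply/asboolP.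
  suff -> : [set x : X | (0 : X -> 'Z_2) x != 0] = set0 by exact: finite_set0.
  by apply/seteqP; split=> x //=; rewrite eqxx.
apply: (@sub_finite_set _ _ ([set x | a x != 0] `|` [set x | b x != 0])).
  move=> x /=; have [ax0|] := eqVneq (a x) 0; last by left.
  have [bx0|] := eqVneq (b x) 0; last by right.
  by rewrite /GRing.add /GRing.opp /= ax0 bx0 subrr eqxx.
by rewrite finite_setU.
Qed.

HB.instance Definition _ :=
  GRing.isZmodClosed.Build (X -> 'Z_2) finsupp_pred finsupp_zmod.

Record dsum := DSum {
  dsum_fun :> X -> 'Z_2;
  dsum_finsupp : dsum_fun \in finsupp_pred
}.

HB.instance Definition _ := [isSub for dsum_fun].
HB.instance Definition _ := [Choice of dsum by <:].
HB.instance Definition _ := [SubChoice_isSubZmodule of dsum by <:].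

Lemma dsum_eq (a b : dsum) : a =1 b -> a = b.
Proof. by move=> /funext ab; apply: val_inj. Qed.

Lemma dsumDE (a b : dsum) x : (a + b) x = a x + b x.
Proof. by []. Qed.

End DirectSum.

Section Semidirect.
Context {R : realType} (X : metricType R).
Notation W := (wobbling X).
Notation A := (dsum X).

(* (g . b) x = b (g^-1 x), so that g maps the basis vector at x to the one at
   g x. *)
Lemma wact_subproof (g : W) (b : A) :
  (fun x => b (winv g x)) \in @finsupp_pred X.
Proof.
case: b => b /= /asboolP fb; apply/asboolP.
apply: (@sub_finite_set _ _ (g @` [set x | b x != 0])).
  by move=> x /= bx; exists (winv g x) => //; rewrite winvK.
exact: finite_image.
Qed.

Definition wact (g : W) (b : A) : A := DSum (wact_subproof g b).

Lemma wact1 b : wact 1%g b = b.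
Proof. by apply: dsum_eq. Qed.

Lemma wactM g h b : wact (g * h)%g b = wact g (wact h b).
Proof. by apply: dsum_eq. Qed.

Lemma wactD g a b : wact g (a + b) = wact g a + wact g b.
Proof. by apply: dsum_eq. Qed.

Lemma wactN g a : wact g (- a) = - wact g a.
Proof. by apply: dsum_eq. Qed.

Definition semidirect : Type := A * W.

HB.instance Definition _ := Choice.on semidirect.

Definition sone : semidirect := (0, 1%g).
Definition smul (u v : semidirect) : semidirect :=
  (u.1 + wact u.2 v.1, (u.2 * v.2)%g).
Definition sinv (u : semidirect) : semidirect :=
  (- wact u.2^-1%g u.1, u.2^-1%g).

Lemma wactr0 g : wact g 0 = 0.
Proof. by apply: dsum_eq. Qed.

Lemma smulA : associative smul.
Proof.
by move=> u v w; rewrite /smul /= wactD wactM addrA mulgA.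
Qed.
Lemma smul1 : left_id sone smul.
Proof. by case=> a g; rewrite /smul /= wact1 add0r mul1g. Qed.
Lemma smulr1 : right_id sone smul.
Proof. by case=> a g; rewrite /smul /= wactr0 addr0 mulg1. Qed.
Lemma smulV : left_inverse sone sinv smul.
Proof. by case=> a g; rewrite /smul /= addNr mulVg. Qed.
Lemma smulrV : right_inverse sone sinv smul.
Proof.
by case=> a g; rewrite /smul /= wactN -wactM mulgV wact1 addrN.
Qed.

HB.instance Definition _ :=
  isGroup.Build semidirect smulA smul1 smulr1 smulV smulrV.

Definition affine_act (u : semidirect) (b : A) : A := u.1 + wact u.2 b.

Lemma affine_act1 b : affine_act 1%g b = b.
Proof. by rewrite /affine_act /= wact1 add0r. Qed.

Lemma affine_actM u v b :
  affine_act (u * v)%g b = affine_act u (affine_act v b).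
Proof. by rewrite /affine_act /= wactD wactM addrA. Qed.

Definition affine_action : action semidirect A := Action affine_act1 affine_actM.

End Semidirect.

(* Main.v *)
Require Import Defs.
From HB Require Import structures.
From mathcomp Require Import all_boot all_order all_algebra.
From mathcomp Require Import finmap.
From mathcomp Require Import all_classical all_reals all_analysis.
From mathcomp Require Import ring lra zify.

Set Implicit Arguments.
Unset Strict Implicit.
Unset Printing Implicit Defensive.

Import Order.TTheory GRing.Theory Num.Theory.
Import numFieldNormedType.Exports.

Local Open Scope classical_set_scope.
Local Open Scope ring_scope.

(** Both halves are about a functional mu on the bounded functions of a finite
  configuration b in the direct sum of copies of Z/2 indexed by X.

  Recurrence implies amenability.  A space is recurrent at scale r exactly when
  the point x0 has zero capacity in the graph joining points at distance at
  most r: there are finitely supported functions f : X -> [0, 1] with f x0 = 1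
  and arbitrarily small Dirichlet energy ([null_capacity_of_return],
  [return_of_null_capacity]).  Turn such an f into a product measure on
  configurations, in which the site x is occupied with probability
  sin^2 (pi/4 f x).  The site x0 carries a fair coin, so the measure is exactly
  invariant by the flip at x0.  A wobbling bijection g of displacement at most
  r sends the product measure of f to that of f o g^-1; the scalar product of
  the square roots of these two measures is the product over x of
  cos (pi/4 (f x - f (g^-1 x))), and 1 minus it is at most the energy of f.
  The measure is therefore almost invariant by g ([approx_invariance]), and an
  ultralimit over a sequence of such f is a mean invariant by the flip at x0
  and by all of W(X).  These generate the whole group, since W(X) acts
  transitively on X ([amenable_of_null_capacity]).

  Spaces over the plane are recurrent.  In Z^2 the function
  f(v) = (1/(|v|+1) + ... + 1/N) / (1 + ... + 1/N), with |v| the sup norm, has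
  energy of order 1/log N: the squared gradient at radius j is of order
  1/(j log N)^2 and there are of order j points at that radius.  The same count
  works in any space with a map to Z^2 that is uniformly finite-to-one and
  increases distances in a controlled way ([planar_null_capacity]); this covers
  Z, Z^2 and everything that embeds coarsely in Z^2.

  Trees obstruct amenability.  Let T be the injective Lipschitz image of the
  binary tree, and mu an invariant mean.  Invariance by the flip at one point of
  T gives mass at least 1/2 to the configurations that meet T.  Averaging over
  the occupied points of T transfers mu to a nonzero finitely additive measure
  Phi on T, invariant by the bijections of T that are wobbling.  For each letter
  b, the map u |-> b :: u from T onto its b-branch is piecewise given by two
  wobbling involutions, one for each parity of the length of u; so both
  branches, which are disjoint, have the full mass of Phi
  ([tree_not_amenable]). *)

(** * Means on bounded functions *)

Section Means.
Variables (R : realType) (Y : Type).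
Implicit Types (f g : linfty R Y) (mu : {linear linfty R Y -> R^o}).

Lemma linfty_eq f g : f =1 g -> f = g.
Proof. by move=> /funext fg; apply: val_inj. Qed.

Lemma linftyDE f g y : (f + g) y = f y + g y.
Proof. by []. Qed.

Lemma linftyBE f g y : (f - g) y = f y - g y.
Proof. by []. Qed.

Definition unit_linfty (f : Y -> R) (f01 : forall y, 0 <= f y <= 1) :
  linfty R Y.
Proof.
apply: (@Linfty R Y f); apply/asboolP; exists 1 => y.
by case/andP: (f01 y) => f0 f1; rewrite ger0_norm.
Defined.

(** If 0 <= f <= 1 then 1 - f has norm at most 1, so that a functional of norm
  1 takes on it a value 1 - mu f at most 1. *)
Lemma mean_ge0 mu f : is_mean mu -> (forall y, 0 <= f y <= 1) -> 0 <= mu f.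
Proof.
move=> [mu1 munorm] f01.
have : (`|mu (linfty_one R Y - f)|%:E <= dual_norm mu)%E.
  apply: ereal_sup_ubound; exists (linfty_one R Y - f) => //=.
  apply: ge_ereal_sup => _ [y _ <-]; rewrite lee_fin.
  have /andP[f0 f1] := f01 y; rewrite linftyBE /=.
  by rewrite ger0_norm ?subr_ge0 // gerBl.
rewrite munorm lee_fin linearB /= mu1 => /ler_normlW.
by rewrite gerBl.
Qed.

Lemma mean_le mu f g : is_mean mu ->
  (forall y, 0 <= f y <= 1) -> (forall y, 0 <= g y <= 1) ->
  (forall y, f y <= g y) -> mu f <= mu g.
Proof.
move=> mumean f01 g01 fg; rewrite -subr_ge0 -linearB mean_ge0 // => y.
rewrite linftyBE subr_ge0 fg /=.
have /andP[f0 f1] := f01 y; have /andP[g0 g1] := g01 y; lra.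
Qed.

Lemma is_mean_of_bound mu : mu (linfty_one R Y) = 1 ->
  (forall f M, (forall y, `|f y| <= M) -> `|mu f| <= M) -> is_mean mu.
Proof.
move=> mu1 mule; split=> //; apply/eqP; rewrite eq_le; apply/andP; split.
  apply: ge_ereal_sup => _ [f /= fle1 <-]; rewrite lee_fin; apply: mule => y.
  by rewrite -lee_fin (le_trans _ fle1) //; apply: ereal_sup_ubound; exists y.
apply: ereal_sup_ubound; exists (linfty_one R Y) => /=; last first.
  by rewrite mu1 normr1.
by apply: ge_ereal_sup => _ [y _ <-]; rewrite lee_fin normr1.
Qed.

End Means.

(** * Basis vectors and wobbling involutions *)

Section DsumElements.
Variable X : eqType.

Lemma delta_subproof (x : X) :
  (fun y => (y == x)%:R : 'Z_2) \in @finsupp_pred X.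
Proof.
apply/asboolP; apply: (@sub_finite_set _ _ [set x]); last exact: finite_set1.
by move=> y /=; case: (y =P x) => // _; rewrite eqxx.
Qed.

Definition delta (x : X) : dsum X := DSum (delta_subproof x).

Lemma deltaE x y : delta x y = (y == x)%:R. Proof. by []. Qed.

Lemma dsum_addrr (a : dsum X) : a + a = 0.
Proof.
by apply: dsum_eq => x; rewrite dsumDE; apply/eqP; case: (a x) => -[|[|]].
Qed.

End DsumElements.

Section WobblingElements.
Variables (R : realType) (X : metricType R).

Definition wobbling_of_involution (s : X -> X) (sK : involutive s)
    (sfin : exists C : R, forall x, mdist x (s x) <= C) : wobbling X :=
  Wobbling sK sK (proj2 (wnormP s) sfin).

Lemma wact_delta (g : wobbling X) x : wact g (delta x) = delta (g x).
Proof.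
apply: dsum_eq => y /=; congr (nat_of_bool _)%:R.
by apply/eqP/eqP => [<-|->]; rewrite ?winvK ?wfunK.
Qed.

End WobblingElements.

(** * The binary tree is paradoxical under its wobbling group *)

Section TreeParadox.

(** The involution that exchanges u and b :: u for all u with a length of
  parity e.  Fixing the parity makes the domain and the range of u |-> b :: u
  disjoint, so that the exchange is well defined. *)
Definition tree_swap (b e : bool) (u : seq bool) : seq bool :=
  if odd (size u) == e then b :: u
  else if u is b' :: u' then if b' == b then u' else u else u.

Lemma tree_swapK b e : involutive (tree_swap b e).
Proof.
move=> u; rewrite {2}/tree_swap; case: eqP => [ue|/eqP ue].
  rewrite /tree_swap /= eqxx; move: ue.
  by case: (odd _) e => -[].
case: u ue => [|b' u] /= ue; first by rewrite /tree_swap /= (negbTE ue).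
case: eqP => [->|/eqP b'b]; last first.
  by rewrite /tree_swap /= (negbTE ue) (negbTE b'b).
by rewrite /tree_swap; move: ue; case: (odd _) e => -[].
Qed.

Lemma tree_swap_dist b e (u : binary_tree) : (gdist u (tree_swap b e u) <= 1)%N.
Proof.
have adj1 (v w : binary_tree) : adj v w -> (gdist v w <= 1)%N.
  by move=> vw; apply: (@gdist_min binary_tree v [:: w]); apply/andP.
rewrite /tree_swap; case: ifP => _.
  by apply: adj1; apply/orP; left; apply/existsP; exists b.
case: u => [|b' u]; first by rewrite gdistxx.
case: ifP => _; last by rewrite gdistxx.
by apply: adj1; apply/orP; right; apply/existsP; exists b'.
Qed.

Definition branch (b : bool) : pred (seq bool) := fun u => ohead u == Some b.

(** Invariance by the swap will thus equate the mass of the words of parity e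
  with that of the words of the b-branch of the other parity. *)
Lemma branch_tree_swap b e u :
  branch b (tree_swap b e u) && (odd (size (tree_swap b e u)) != e)
  = (odd (size u) == e).
Proof.
rewrite /branch /tree_swap; case: ifP => [/eqP ue|ue] /=.
  by rewrite eqxx /= ue; case: e {ue}.
case: u ue => [|b' u] //= ue.
have [_|b'b] := eqVneq b' b; last by rewrite /= (inj_eq Some_inj) (negbTE b'b).
by move: ue; case: (odd _) e => -[] //; rewrite ?andbF.
Qed.

End TreeParadox.

Section Nonamenable.
Variables (R : realType) (X : metricType R).
Variable f : graph_space R binary_tree -> X.
Hypotheses (f_inj : injective f) (f_lip : lipschitz_map f).

Definition extend_by_id (s : seq bool -> seq bool) (x : X) : X :=
  if pselect (exists u, f u = x) is left e then f (s (sval (cid e))) else x.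

Lemma extend_by_idE s u : extend_by_id s (f u) = f (s u).
Proof.
rewrite /extend_by_id; case: pselect => [e|[]]; last by exists u.
by case: cid => v /= /f_inj ->.
Qed.

Lemma extend_by_id_out s x : ~ (exists u, f u = x) -> extend_by_id s x = x.
Proof. by rewrite /extend_by_id; case: pselect. Qed.

Lemma extend_by_idK s : involutive s -> involutive (extend_by_id s).
Proof.
move=> sK x; have [[u <-]|xf] := pselect (exists u, f u = x).
  by rewrite !extend_by_idE sK.
by rewrite !(extend_by_id_out _ xf).
Qed.

Lemma extend_by_id_dist (s : binary_tree -> binary_tree) n :
  (forall u, gdist u (s u) <= n)%N ->
  exists C : R, forall x, mdist x (extend_by_id s x) <= C.
Proof.
move=> sn; have [L fL] := f_lip; exists (`|L| * n%:R) => x.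
have [[u <-]|xf] := pselect (exists u, f u = x).
  rewrite extend_by_idE (le_trans (fL _ _)) //.
  rewrite (le_trans (ler_norm _)) // normrM ler_wpM2l //.
  by rewrite ger0_norm ?mdist_ge0 // ler_nat.
by rewrite (extend_by_id_out _ xf) mdistxx mulr_ge0.
Qed.

Definition tree_wobbling b e : wobbling X :=
  wobbling_of_involution (extend_by_idK (@tree_swapK b e))
    (extend_by_id_dist (tree_swap_dist b e)).

Definition tree_support (a : dsum X) : {fset seq bool} :=
  fset_set [set u | a (f u) != 0].

Lemma in_tree_support a u : (u \in tree_support a) = (a (f u) != 0).
Proof.
rewrite in_fset_set; last first.
  case: a => a /= /asboolP fina.
  by apply: finite_preimage fina => ? ? _ _ /f_inj.
by apply/idP/idP => [/set_mem|/mem_set].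

Qed.

(** The proportion, among the occupied points of the tree, of those in P.  When
  the tree has no occupied point the value is 0 / 0 = 0, so that
  [tree_fraction predT] is the indicator of the configurations that meet the
  tree. *)
Definition tree_fraction (P : pred (seq bool)) (a : dsum X) : R :=
  (count P (tree_support a))%:R / (size (tree_support a))%:R.

Lemma tree_fraction01 P a : 0 <= tree_fraction P a <= 1.
Proof.
rewrite /tree_fraction divr_ge0 //=.
have [->|s0] := posnP (size (tree_support a)); first by rewrite invr0 mulr0.
by rewrite ler_pdivrMr ?ltr0n // mul1r ler_nat count_size.
Qed.

Definition tree_density P : linfty R (dsum X) :=
  unit_linfty (tree_fraction01 P).

Lemma tree_fraction_swap b e P a :
  tree_fraction P (wact (tree_wobbling b e) a) =
  tree_fraction (P \o tree_swap b e) a.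
Proof.
have sinj := inv_inj (@tree_swapK b e).
have ps : perm_eq (tree_support (wact (tree_wobbling b e) a))
    (map (tree_swap b e) (tree_support a)).
  apply: uniq_perm => [||u]; rewrite ?map_inj_uniq ?fset_uniq //.
  rewrite -{2}(tree_swapK b e u) mem_map // !in_tree_support /=.
  by rewrite extend_by_idE.
rewrite /tree_fraction (permP ps) (perm_size ps) size_map count_map.
by congr (_%:R / _); apply: eq_count.
Qed.

(** The set function Phi P = mu (tree_density P) is additive and gives each of
  the two disjoint branches the mass of the whole tree, hence vanishes; but the
  flip at the image of the root shows that the tree has mass at least 1/2. *)
Lemma tree_not_amenable : ~ amenable_action R (affine_action X).
Proof.
move=> [mu mumean muinv].
pose Phi P := mu (tree_density P).
have Phi_ext P Q : P =1 Q -> Phi P = Phi Q.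
  move=> PQ; congr (mu _); apply: linfty_eq => a.
  by rewrite /= /tree_fraction (eq_count PQ).
have PhiD P Q : (forall u, ~~ (P u && Q u)) ->
    Phi (predU P Q) = Phi P + Phi Q.
  move=> dPQ; rewrite -linearD; congr (mu _); apply: linfty_eq => a.
  rewrite linftyDE /= /tree_fraction -mulrDl -natrD -count_predUI.
  have -> : count (predI P Q) (tree_support a) = 0%N; last by rewrite addn0.
  apply/eqP; rewrite -leqn0 leqNgt -has_count.
  by apply/hasP => -[u _]; exact/negP/dPQ.
have Phi_swap b e P : Phi (P \o tree_swap b e) = Phi P.
  rewrite /Phi -(muinv (0, tree_wobbling b e) (tree_density P)).
  congr (mu _); apply: linfty_eq => a /=.
  by rewrite /affine_act add0r tree_fraction_swap.
pose par e : pred (seq bool) := fun u => odd (size u) == e.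
have PhiT : Phi predT = Phi (par true) + Phi (par false).
  rewrite -PhiD => [|u]; last by rewrite /par; case: odd.
  by apply: Phi_ext => u; rewrite /= /par; case: odd.
have Phi_branch b : Phi (branch b) = Phi predT.
  pose Q e : pred (seq bool) := fun u => branch b u && (odd (size u) != e).
  have QE e : Phi (Q e) = Phi (par e).
    by rewrite -(Phi_swap b e); apply: Phi_ext => u; exact: branch_tree_swap.
  rewrite PhiT -!QE -PhiD => [|u]; last first.
    by rewrite /Q; case: branch; case: odd.
  by apply: Phi_ext => u; rewrite /= /Q; case: branch; case: odd.
have PhiT0 : Phi predT <= 0.
  have : Phi (predU (branch true) (branch false)) <= Phi predT.
    apply: mean_le => // [a|a|a]; do ?exact: tree_fraction01.
    by rewrite ler_wpM2r ?invr_ge0 // ler_nat sub_count.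
  rewrite PhiD ?Phi_branch; first by lra.
  by move=> u; rewrite /branch; case: u => [|[]].
pose x0 : X := f [::].
have I01 (a : dsum X) : 0 <= ((a x0 == 0)%:R : R) <= 1.
  by case: eqP; rewrite /= ?lexx ler01.
(* The event that the root is vacant is exchanged with its complement by the
   flip at the root, hence has mass 1/2; it contains the event that the tree
   has no occupied point. *)
pose I := unit_linfty I01.
have I2 : mu I = 1 / 2.
  have := muinv (delta x0, 1%g) I.
  have -> : linfty_comp I (affine_action X (delta x0, 1%g)) =
      linfty_one R _ - I.
    apply: linfty_eq => a.
    change (((delta x0 + wact 1%g a) x0 == 0)%:R = 1 - (a x0 == 0)%:R :> R).
    rewrite wact1 dsumDE deltaE eqxx /=.
    by case: (a x0) => -[|[|]] //= ?; rewrite ?subrr ?subr0.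
  rewrite linearB /= mumean.1; lra.
have : 1 - mu I <= Phi predT.
  rewrite -mumean.1 -linearB; apply: mean_le => // [a|a|a].
  - by rewrite linftyBE /=; have := I01 a; lra.
  - exact: tree_fraction01.
  rewrite linftyBE /=; have [ax0|ax0] := eqVneq (a x0) 0.
    by rewrite subrr; case/andP: (tree_fraction01 predT a).
  rewrite subr0 /tree_fraction count_predT divff // pnatr_eq0 size_eq0.
  have : [::] \in enum_fset (tree_support a) by rewrite in_tree_support.
  by case: (enum_fset _).
lra.
Qed.

End Nonamenable.

(** * Product measures and their Hellinger distance *)

Section CosineBounds.
Variable R : realType.
Implicit Types x : R.

Lemma normr_sin_le x : `|sin x| <= `|x|.
Proof.
wlog x0 : x / 0 <= x.
  move=> le_pos; case: (leP 0 x) => [|x0]; first exact: le_pos.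
  by rewrite -(opprK x) sinN 2!normrN le_pos // oppr_ge0 ltW.
have [|c _] := @MVT_segment _ (@sin R) cos 0 x x0 (fun y _ => is_derive_sin y).
  by apply: continuous_subspaceT => y; exact: continuous_sin.
rewrite sin0 !subr0 => ->; rewrite normrM ler_piMl // ler_norml.
by rewrite cos_le1 cos_geN1.
Qed.

Lemma one_sub_cos_le x : 1 - cos x <= x ^+ 2.
Proof.
have -> : cos x = 1 - (sin (x / 2)) ^+ 2 *+ 2.
  by rewrite {1}[x]splitr -mulr2n cos_mulr2n cos2sin2; ring.
have : `|sin (x / 2)| ^+ 2 <= `|x / 2| ^+ 2.
  by rewrite ler_pXn2r ?nnegrE // normr_sin_le.
rewrite !real_normK ?num_real // exprMn => le2.
have : 0 <= x ^+ 2 by exact: sqr_ge0.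
lra.
Qed.

Lemma cos2_pi4 : cos (pi / 4 : R) ^+ 2 = 1 / 2.
Proof.
have := @cos_pihalf R.
have -> : pi / 2 = (pi / 4) *+ 2 :> R by field.
by rewrite cos_mulr2n; lra.
Qed.

Lemma sin2_pi4 : sin (pi / 4 : R) ^+ 2 = 1 / 2.
Proof. by rewrite sin2cos2 cos2_pi4; field. Qed.

Lemma one_sub_prod_le (I : eqType) (s : seq I) (p : I -> R) :
  (forall i, 0 <= p i <= 1) ->
  1 - \prod_(i <- s) p i <= \sum_(i <- s) (1 - p i).
Proof.
move=> p01; have prod01 t : 0 <= \prod_(i <- t) p i <= 1.
  elim: t => [|i t /andP[IH0 IH1]]; rewrite ?big_nil ?lexx ?ler01 // big_cons.
  by have /andP[p0 p1] := p01 i; rewrite mulr_ge0 ?mulr_ile1.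
elim: s => [|i s IH]; first by rewrite !big_nil subrr.
rewrite !big_cons; have /andP[p0 p1] := p01 i; have /andP[P0 P1] := prod01 s.
nra.
Qed.

End CosineBounds.

Section ProductMeasure.
Variables (R : realType) (X : eqType).
Implicit Types (th : X -> R) (s : seq X) (F G : dsum X -> R).

(** The expectation of F when the sites x of s are occupied independently with
  probability sin^2 (th x) and all other sites are vacant; s is meant to be
  duplicate-free.  The recursion draws the sites one after the other, which
  makes each property below a short induction and avoids sums over
  configurations. *)
Fixpoint bernoulli_exp th s F : R :=
  if s is x :: s' then
    cos (th x) ^+ 2 * bernoulli_exp th s' F +
    sin (th x) ^+ 2 * bernoulli_exp th s' (fun b => F (delta x + b))
  else F 0.

Lemma bernoulli_expD th s F G :
  bernoulli_exp th s (fun b => F b + G b) =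
  bernoulli_exp th s F + bernoulli_exp th s G.
Proof. by elim: s F G => [|x s IH] F G //=; rewrite !IH; ring. Qed.

Lemma bernoulli_expZ th s a F :
  bernoulli_exp th s (fun b => a * F b) = a * bernoulli_exp th s F.
Proof. by elim: s F => [|x s IH] F //=; rewrite !IH; ring. Qed.

Lemma bernoulli_exp_cst th s a : bernoulli_exp th s (fun=> a) = a.
Proof. by elim: s => [|x s IH] //=; rewrite IH -mulrDl cos2Dsin2 mul1r. Qed.

Lemma bernoulli_exp_norm_le th s F M :
  (forall b, `|F b| <= M) -> `|bernoulli_exp th s F| <= M.
Proof.
elim: s F => [|x s IH] F FM //=.
rewrite (le_trans (ler_normD _ _)) //.
rewrite (normrM (cos _ ^+ 2)) (normrM (sin _ ^+ 2)) !(ger0_norm (sqr_ge0 _)).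
rewrite -[leRHS]mul1r -(cos2Dsin2 (th x)) mulrDl.
by rewrite lerD // ler_wpM2l ?sqr_ge0 // IH.
Qed.

Lemma bernoulli_exp_swap th x y s F :
  bernoulli_exp th (x :: y :: s) F = bernoulli_exp th (y :: x :: s) F.
Proof.
move=> /=; have -> : (fun b => F (delta x + (delta y + b))) =
    (fun b => F (delta y + (delta x + b))).
  by apply/funext => b; rewrite addrCA.
ring.
Qed.

Lemma bernoulli_exp_rem th x s F : x \in s ->
  bernoulli_exp th s F = bernoulli_exp th (x :: rem x s) F.
Proof.
elim: s F => [|y s IH] F //; rewrite inE.
have [->|xy] := eqVneq y x; first by rewrite /= eqxx.
move=> /= xs; rewrite (negbTE xy) !(IH _ xs)
  -[RHS]/(bernoulli_exp th (x :: y :: rem x s) F).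
by rewrite bernoulli_exp_swap.
Qed.

Lemma bernoulli_exp_perm th s t F : perm_eq s t ->
  bernoulli_exp th s F = bernoulli_exp th t F.
Proof.
elim: s t F => [|x s IH] t F; first by rewrite perm_sym => /perm_nilP ->.
move=> st; have xt : x \in t by rewrite -(perm_mem st) mem_head.
rewrite (bernoulli_exp_rem _ _ xt) /= !(IH (rem x t)) //.
all: by rewrite -(perm_cons x) (perm_trans st) // perm_to_rem.
Qed.

(** A site of angle 0 is almost surely vacant. *)
Lemma bernoulli_exp_filter th s F :
  bernoulli_exp th s F = bernoulli_exp th [seq x <- s | th x != 0] F.
Proof.
elim: s F => [|x s IH] F //=; case: eqP => [->|_] /=; last by rewrite -!IH.
by rewrite cos0 sin0 expr1n expr0n mul1r mul0r addr0 IH.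
Qed.

Lemma bernoulli_exp_support th s t F : uniq s -> uniq t ->
  (forall x, th x != 0 -> (x \in s) && (x \in t)) ->
  bernoulli_exp th s F = bernoulli_exp th t F.
Proof.
move=> us ut st; rewrite bernoulli_exp_filter [RHS]bernoulli_exp_filter.
apply: bernoulli_exp_perm; apply: uniq_perm; rewrite ?filter_uniq // => x.
by rewrite !mem_filter; case: eqVneq => //= /st/andP[-> ->].
Qed.

(** At the angle pi/4 the coordinate is a fair coin, hence is invariant by a
  flip. *)
Lemma bernoulli_exp_flip th s x F : x \in s -> th x = pi / 4 ->
  bernoulli_exp th s (fun b => F (delta x + b)) = bernoulli_exp th s F.
Proof.
move=> xs thx; rewrite !(bernoulli_exp_rem _ _ xs) /= thx cos2_pi4 sin2_pi4.
have -> : (fun b => F (delta x + (delta x + b))) = F.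
  by apply/funext => b; rewrite addrA dsum_addrr add0r.
by rewrite addrC.
Qed.

Definition affinity th th' s : R := \prod_(x <- s) cos (th x - th' x).

(** The product measures of angles th and th' are the squares of two unit
  vectors xi and xi', with scalar product the affinity.  The inequality is the
  integrated form of 2 l |p^2 - q^2| <= (p - q)^2 + l^2 (p + q)^2, for
  p = A xi and q = B xi'.  The scalars A and B make the statement inductive:
  conditioning on the first site multiplies them by its coordinates, either
  (cos, cos) or (sin, sin), and cos cos' + sin sin' = cos (th x - th' x)
  recovers the affinity. *)
Lemma hellinger_bound th th' s F M l (A B : R) :
  0 <= l -> (forall b, `|F b| <= M) ->
  2 * l * `|A ^+ 2 * bernoulli_exp th s F - B ^+ 2 * bernoulli_exp th' s F| <=
  M * ((A ^+ 2 + B ^+ 2 - 2 * A * B * affinity th th' s)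
       + l ^+ 2 * (A ^+ 2 + B ^+ 2 + 2 * A * B * affinity th th' s)).
Proof.
move=> l0; elim: s F A B => [|x s IH] F A B FM.
  rewrite /affinity big_nil !mulr1 /= -mulrBl normrM mulrA mulrC.
  have -> : A ^+ 2 - B ^+ 2 = (A - B) * (A + B) by ring.
  have -> : A ^+ 2 + B ^+ 2 - 2 * A * B + l ^+ 2 * (A ^+ 2 + B ^+ 2 + 2 * A * B)
      = `|A - B| ^+ 2 + l ^+ 2 * `|A + B| ^+ 2.
    by rewrite !real_normK ?num_real //; ring.
  rewrite normrM; set u := `|A - B|; set v := `|A + B|.
  have le1 : 2 * l * (u * v) <= u ^+ 2 + l ^+ 2 * v ^+ 2.
    by rewrite -subr_ge0; have := sqr_ge0 (u - l * v); rewrite sqrrB; lra.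
  apply: (le_trans (ler_wpM2l (normr_ge0 _) le1)).
  by apply: ler_wpM2r (FM 0); rewrite addr_ge0 ?sqr_ge0 // mulr_ge0 ?sqr_ge0.
rewrite {1 2}/affinity big_cons cosB -/(affinity _ _ s) /=.
have := IH F (A * cos (th x)) (B * cos (th' x)) FM.
have := IH (fun b => F (delta x + b)) (A * sin (th x)) (B * sin (th' x))
  (fun b => FM _).
set rho := affinity _ _ s.
set a := cos (th x); set b := sin (th x).
set a' := cos (th' x); set b' := sin (th' x).
set E0 := bernoulli_exp th s F; set E1 := bernoulli_exp th s _.
set E0' := bernoulli_exp th' s F; set E1' := bernoulli_exp th' s _.
move=> le1 le0.
have ab : b ^+ 2 = 1 - a ^+ 2 by exact: sin2cos2.
have ab' : b' ^+ 2 = 1 - a' ^+ 2 by exact: sin2cos2.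
have {le0 le1} := lerD le0 le1.
rewrite -[leRHS]mulrDr.
have -> : (A * a) ^+ 2 + (B * a') ^+ 2 - 2 * (A * a) * (B * a') * rho
   + l ^+ 2 * ((A * a) ^+ 2 + (B * a') ^+ 2 + 2 * (A * a) * (B * a') * rho)
   + ((A * b) ^+ 2 + (B * b') ^+ 2 - 2 * (A * b) * (B * b') * rho
   + l ^+ 2 * ((A * b) ^+ 2 + (B * b') ^+ 2 + 2 * (A * b) * (B * b') * rho))
   = A ^+ 2 + B ^+ 2 - 2 * A * B * ((a * a' + b * b') * rho)
   + l ^+ 2 * (A ^+ 2 + B ^+ 2 + 2 * A * B * ((a * a' + b * b') * rho)).
  by rewrite !exprMn ab ab'; ring.
apply: le_trans; rewrite -mulrDr ler_wpM2l ?mulr_ge0 //.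
have -> : A ^+ 2 * (a ^+ 2 * E0 + b ^+ 2 * E1) -
    B ^+ 2 * (a' ^+ 2 * E0' + b' ^+ 2 * E1') =
    ((A * a) ^+ 2 * E0 - (B * a') ^+ 2 * E0') +
    ((A * b) ^+ 2 * E1 - (B * b') ^+ 2 * E1') by ring.
exact: ler_normD.
Qed.

End ProductMeasure.

(** * Means as ultralimits *)

Section UltralimitMean.
Variables (R : realType) (Y : Type).
Variable E : nat -> linfty R Y -> R.
Hypothesis E_linear : forall n (a : R) (f g : linfty R Y),
  E n (a *: f + g) = a * E n f + E n g.
Hypothesis E_one : forall n, E n (linfty_one R Y) = 1.
Hypothesis E_bound : forall n (f : linfty R Y) (M : R),
  (forall y, `|f y| <= M) -> `|E n f| <= M.

(** The limit exists along an ultrafilter finer than the cofinite filter, by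
  compactness of segments, and agrees with the ordinary limit when that
  exists. *)
Lemma ultralimit_mean : exists2 mu : {linear linfty R Y -> R^o},
  is_mean mu & forall f g : linfty R Y,
    (fun n => E n f - E n g) @ \oo --> (0 : R) -> mu f = mu g.
Proof.
have [U [Uultra Ucofin]] := @ultraFilterLemma nat \oo _.
have Ucvg f : exists l : R, (fun n => E n f) @ U --> l.
  have [M fM] : exists M : R, forall y, `|f y| <= M.
    by case: f => f /= /asboolP.
  have UM : ((fun n => E n f) @ U) [set` `[- M, M]].
    apply: (@filterE _ U) => n; rewrite /= in_itv /= -ler_norml.
    exact: E_bound.
  have [l [_ lclus]] := segment_compact _ UM.
  exists l => B Bl.
  have [//|UB] := in_ultra_setVsetC [set n | B (E n f)] Uultra.
  by have [y [/= nBy By]] := lclus (~` B) B UB Bl.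
pose mu0 (f : linfty R Y) : R^o := lim ((fun n => E n f) @ U).
have mu0P f : (fun n => E n f) @ U --> (mu0 f : R).
  by have [l fl] := Ucvg f; rewrite /mu0 (cvg_lim _ fl).
have mu0_linear : linear mu0.
  move=> a f g; apply: cvg_lim => //.
  under eq_fun do rewrite E_linear.
  by apply: cvgD; [apply: cvgZl_tmp|]; exact: mu0P.
pose mu : {linear linfty R Y -> R^o} :=
  HB.pack mu0 (GRing.isLinear.Build _ _ _ _ mu0 mu0_linear).
exists mu.
  apply: is_mean_of_bound => [|f M fM].
    apply: cvg_lim => //; under eq_fun do rewrite E_one; exact: cvg_cst.
  apply: (ler_cvg_to (cvg_norm (mu0P f)) (cvg_cst M)).
  by apply: filterE => n; exact: E_bound.
move=> f g fg; apply/eqP; rewrite -subr_eq0; apply/eqP.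
apply: (cvg_unique _ (cvgB (mu0P f) (mu0P g))) => //.
by apply: cvg_trans fg; exact: cvg_app.
Qed.

End UltralimitMean.

(** * Energy and capacity *)

Lemma ler_sum_uniq_sub (R : numDomainType) (T : eqType) (s t : seq T)
    (F : T -> R) :
  uniq s -> uniq t -> {subset s <= t} -> (forall x, x \in t -> 0 <= F x) ->
  \sum_(x <- s) F x <= \sum_(x <- t) F x.
Proof.
move=> us ut st F0; rewrite [leRHS](bigID (mem s)) /=.
have ps : perm_eq s [seq x <- t | x \in s].
  apply: uniq_perm; rewrite ?filter_uniq // => x; rewrite mem_filter.
  by apply/idP/andP => [xs|[]] //; rewrite xs st.
rewrite (perm_big _ ps) big_filter lerDl big_seq_cond sumr_ge0 // => x.
by move=> /andP[xt _]; exact: F0.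
Qed.

Section NullCapacity.
Variables (R : realType) (X : metricType R).

Definition energy (r : R) (A : {fset X}) (f : X -> R) : R :=
  \sum_(x <- A) \sum_(y <- A | mdist x y <= r) (f x - f y) ^+ 2.

(** The point x0 has capacity zero in the graph of points at distance at most
  r.  Bounding the partial energies over all finite sets bounds the energy over
  the whole of X without infinite sums. *)
Definition null_capacity (r : R) (x0 : X) : Prop :=
  forall e, 0 < e -> exists f : X -> R,
    [/\ exists A : {fset X}, forall x, x \notin A -> f x = 0,
        forall x, 0 <= f x <= 1,
        f x0 = 1 &
        forall A : {fset X}, energy r A f <= e].

Lemma wact_deltaD (g : wobbling X) x (b : dsum X) :
  wact g (delta x + b) = delta (g x) + wact g b.
Proof. by rewrite wactD wact_delta. Qed.

(** As g maps delta x + b to delta (g x) + g b, it turns the draw at x into a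
  draw at g x with the same angle. *)
Lemma bernoulli_exp_wact (g : wobbling X) th s (F : dsum X -> R) :
  bernoulli_exp th s (fun b => F (wact g b)) =
  bernoulli_exp (th \o winv g) (map g s) F.
Proof.
elim: s F => [|x s IH] F /=; first by rewrite wactr0.
rewrite wfunK IH; congr (_ + _ * _).
rewrite -(IH (fun b => F (delta (g x) + b))).
by congr bernoulli_exp; apply/funext => b; rewrite wact_deltaD.
Qed.

(** The pairs (x, g^-1 x) are among the pairs of points at distance at most
  r. *)
Lemma displacement_energy (g : wobbling X) r (f : X -> R) (s : seq X) :
  (forall x, mdist x (g x) <= r) -> uniq s ->
  exists A : {fset X}, \sum_(x <- s) (f x - f (winv g x)) ^+ 2 <= energy r A f.
Proof.
move=> gr us; exists [fset x in s ++ map (winv g) s]%fset.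
set A := [fset x in _]%fset; rewrite /energy.
have sA x : x \in s -> (x \in A) && (winv g x \in A).
  by move=> xs; rewrite !in_fset !mem_cat xs map_f // orbT.
apply: (le_trans _ (ler_sum_uniq_sub us (fset_uniq A) _ _)) =>
  [|x /sA/andP[]|x _] //.
  rewrite big_seq [leRHS]big_seq; apply: ler_sum => x xs.
  have /andP[_ gxA] := sA x xs.
  have gxr : mdist x (winv g x) <= r by rewrite metric_sym -{2}(winvK g x).
  rewrite big_mkcond /= (big_rem _ gxA) /= gxr lerDl sumr_ge0 // => y _.
  by case: ifP => // _; exact: sqr_ge0.
by apply: sumr_ge0 => y _; exact: sqr_ge0.
Qed.

End NullCapacity.

(** * Zero capacity implies amenability *)

Section Amenability.
Variables (R : realType) (X : metricType R).

Definition angle (f : X -> R) : X -> R := fun x => pi / 4 * f x.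

(** Comparing the measures of f and f o g^-1 by the Hellinger bound with weight
  l: the defect 1 - affinity is at most the energy, hence at most l^2. *)
Lemma approx_invariance (g : wobbling X) r l (f : X -> R) (A : {fset X})
    (F : dsum X -> R) M :
  (forall x, mdist x (g x) <= r) -> 0 < l ->
  (forall x, x \notin A -> f x = 0) -> (forall x, 0 <= f x <= 1) ->
  (forall B, energy r B f <= l ^+ 2) -> (forall b, `|F b| <= M) ->
  `|bernoulli_exp (angle f) A (fun b => F (wact g b))
    - bernoulli_exp (angle f) A F| <= 3 * M * l.
Proof.
move=> gr l0 fA f01 fE FM; rewrite bernoulli_exp_wact.
set th := angle f; set th' := th \o winv g.
pose u := undup (enum_fset A ++ map g A).
have thA x : th x != 0 -> x \in A.
  by apply: contraNT => /fA fx0; rewrite /th /angle fx0 mulr0.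
have Au x : x \in A -> x \in u by rewrite mem_undup mem_cat => ->.
have gAu x : x \in map g A -> x \in u.
  by rewrite mem_undup mem_cat => ->; rewrite orbT.
rewrite (@bernoulli_exp_support _ _ th _ u) ?undup_uniq ?fset_uniq //;
  last first.
  by move=> x /thA xA; rewrite xA Au.
rewrite (@bernoulli_exp_support _ _ th' _ u) ?undup_uniq //; last 2 first.
- by rewrite (map_inj_uniq (can_inj (wfunK g))) fset_uniq.
- move=> x /thA xA.
  have xgA : x \in map g A by rewrite -(winvK g x) map_f.
  by rewrite xgA gAu.
set D := _ - _.
have pi4 : 0 <= (pi / 4 : R) <= 1.
  by have := @pihalf_02 R; have := @pi_gt0 R; move: (pi : R) => p; lra.
have thB x y : `|th x - th y| <= pi / 4.
  rewrite /th /angle -mulrBr normrM ger0_norm; last by case/andP: pi4.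
  rewrite ler_piMr //; first by case/andP: pi4.
  have /andP[fx0 fx1] := f01 x; have /andP[fy0 fy1] := f01 y.
  by rewrite ler_norml; apply/andP; split; lra.
have cos01 x : 0 <= cos (th' x - th x) <= 1.
  rewrite cos_le1 andbT cos_ge0_pihalf //.
  have := thB (winv g x) x; have := @pi_gt0 R.
  by rewrite ler_norml /th' /=; move: (th _) (th x) (pi : R) => a b p; lra.
have rho1 : affinity th' th u <= 1.
  rewrite /affinity; elim/big_rec: _ => // x p _ p1.
  by have := cos01 x; nra.
have rhol : 1 - affinity th' th u <= l ^+ 2.
  rewrite (le_trans (one_sub_prod_le _ cos01)) //.
  have [B fB] := displacement_energy f gr (undup_uniq (enum_fset A ++ map g A)).
  rewrite (le_trans _ (le_trans fB (fE B))) //; apply: ler_sum => x _.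
  rewrite (le_trans (one_sub_cos_le _)) // /th' /th /angle /= -mulrBr exprMn.
  rewrite -(sqrrN (f x - _)) opprB ler_piMl ?sqr_ge0 //.
  by case/andP: pi4 => ? ?; rewrite exprn_ile1.
have M0 : 0 <= M by exact: le_trans (normr_ge0 _) (FM 0).
have := hellinger_bound th' th u 1 1 (ltW l0) FM.
rewrite expr1n !mulr1 !mul1r -/D; set rho := affinity _ _ _ in rho1 rhol *.
move=> lD; have {}lD : 2 * l * `|D| <= 2 * l * (3 * M * l).
  apply: (le_trans lD).
  have -> : 2 * l * (3 * M * l) = M * (6 * l ^+ 2) by ring.
  have := sqr_ge0 l; rewrite ler_wpM2l //; nra.
by rewrite -(ler_pM2l (_ : 0 < 2 * l)) // mulr_gt0.
Qed.

Definition transposition (x y : X) (z : X) : X :=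
  if z == x then y else if z == y then x else z.

Lemma transpositionK x y : involutive (transposition x y).
Proof.
move=> z; rewrite /transposition; have [->|zx] := eqVneq z x.
  by rewrite eqxx; case: eqP.
by have [->|zy] := eqVneq z y; rewrite ?eqxx // (negbTE zx) (negbTE zy).
Qed.

Lemma transposition_dist x y :
  exists C : R, forall z, mdist z (transposition x y z) <= C.
Proof.
exists (mdist x y) => z; rewrite /transposition; case: eqP => [->//|_].
by case: eqP => [->|_]; rewrite ?mdistxx ?mdist_ge0 // metric_sym.
Qed.

Definition wtransposition x y : wobbling X :=
  wobbling_of_involution (transpositionK x y) (transposition_dist x y).

(** At stage n, take a function f of energy at most 1/(n+1)^2 at scale n+1.
  The limit mean is invariant by the flip at x0, because each of the product
  measures is, and by every g in W(X), because the scale eventually exceeds the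
  displacement of g.  Conjugating the flip at x0 by a transposition of W(X)
  gives the flip at any other site, and flips generate the translations. *)
Lemma amenable_of_null_capacity (x0 : X) :
  (forall r, 0 < r -> null_capacity r x0) ->
  amenable_action R (affine_action X).
Proof.
move=> cap0; pose l n : R := n.+1%:R^-1.
have l0 n : 0 < l n by rewrite invr_gt0 ltr0n.
have /choice[d dP] : forall n, exists d : (X -> R) * {fset X},
    [/\ forall x, x \notin d.2 -> d.1 x = 0, forall x, 0 <= d.1 x <= 1,
        d.1 x0 = 1 & forall B, energy n.+1%:R B d.1 <= l n ^+ 2].
  move=> n.
  have [|f [[A fA] f01 fx0 fE]] := cap0 n.+1%:R (ltr0Sn _ _) (l n ^+ 2).
    by rewrite exprn_gt0.
  by exists (f, A).
pose E n (F : linfty R (dsum X)) : R := bernoulli_exp (angle (d n).1) (d n).2 F.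
have [|||mu mumean muE] := @ultralimit_mean R (dsum X) E.
- by move=> n a F G; rewrite /E -bernoulli_expZ -bernoulli_expD.
- by move=> n; exact: bernoulli_exp_cst.
- by move=> n F M; exact: bernoulli_exp_norm_le.
exists mu => //.
pose invariant u :=
  forall F, mu (linfty_comp F (affine_action X u)) = mu F.
have invM u v : invariant u -> invariant v -> invariant (u * v)%g.
  move=> iu iv F; rewrite -(iu F) -(iv (linfty_comp F (affine_action X u))).
  congr (mu _); apply: linfty_eq => b.
  by apply: (congr1 (linfty_fun F)); exact: affine_actM.
pose W g : semidirect X := (0, g).
pose T a : semidirect X := (a, 1%g).
have invW g : invariant (W g).
  move=> F; apply: muE; have [M FM] : exists M : R, forall b, `|F b| <= M.
    by case: F => F /= /asboolP.
  have [C gC] := proj1 (wnormP g) (wfun_fin g).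
  apply/cvgr0Pnorm_le => e e0.
  apply: filterS2 (nbhs_infty_ger C) (nbhs_infty_ger (3 * M / e)) => n Cn en.
  have [dA d01 dx0 dE] := dP n.
  have -> : E n (linfty_comp F (affine_action X (W g))) =
      bernoulli_exp (angle (d n).1) (d n).2 (fun b => F (wact g b)).
    by congr bernoulli_exp; apply/funext => b /=; rewrite /affine_act add0r.
  have approx := approx_invariance (g := g) _ (l0 n) dA d01 dE FM.
  apply: (le_trans (approx _)) => //.
    move=> x; rewrite (le_trans (gC x)) // (le_trans Cn) ?ler_nat //.
  rewrite /l ler_pdivrMr ?ltr0n // [e * _]mulrC -ler_pdivrMr //.
  by rewrite (le_trans en) ?ler_nat.
have invx0 : invariant (T (delta x0)).
  move=> F; apply: muE; apply: cvg_near_cst; apply: nearW => n.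
  have [dA d01 dx0 dE] := dP n; apply/eqP; rewrite subr_eq0; apply/eqP.
  have -> : E n (linfty_comp F (affine_action X (T (delta x0)))) =
      bernoulli_exp (angle (d n).1) (d n).2 (fun b => F (delta x0 + b)).
    by congr bernoulli_exp; apply/funext => b /=; rewrite /affine_act wact1.
  apply: bernoulli_exp_flip; last by rewrite /angle dx0 mulr1.
  by apply/negPn/negP => /dA; rewrite dx0 => /eqP; rewrite oner_eq0.
have invx x : invariant (T (delta x)).
  have -> : T (delta x) =
      (W (wtransposition x0 x) * T (delta x0) * W (wtransposition x0 x))%g.
    rewrite -[RHS]/(smul (smul _ _) _) /smul /= wactr0 addr0 add0r wact_delta.
    congr pair.
      by rewrite /= /transposition eqxx.
    by apply: wobbling_eq => y /=; rewrite transpositionK.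
  by apply: (invM _ _ (invM _ _ _ _)); [exact: invW|exact: invx0|exact: invW].
have invA a : invariant (T a).
  have [s] : exists s : seq X, forall x, a x != 0 -> x \in s.
    case: a => a /= /asboolP fina; exists (fset_set [set x | a x != 0]) => x ax.
    by rewrite in_fset_set // mem_set.
  elim: s a => [|x s IH] a sa.
    have -> : a = 0 by apply: dsum_eq => x; apply/eqP/negPn/negP => /sa.
    by exact: (invW 1%g).
  have [ax0|ax0] := eqVneq (a x) 0.
    apply: IH => y ay; have := sa y ay; rewrite inE; case: eqP => // yx _.
    by move: ay; rewrite yx ax0 eqxx.
  have -> : T a = (T (delta x) * T (delta x + a))%g.
    rewrite -[RHS]/(smul _ _) /smul /= wact1 addrA dsum_addrr add0r; congr pair.
    by rewrite mulg1.
  apply: invM => //; apply: IH => y; rewrite dsumDE deltaE.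
  have [->|yx] := eqVneq y x; last first.
    by rewrite add0r => /sa; rewrite inE (negbTE yx).
  by move: ax0; case: (a x) => -[|[|]].
move=> [a g] F.
have -> : (a, g) = (T a * W g)%g.
  by rewrite -[RHS]/(smul _ _) /smul /= wactr0 addr0 mul1g.
exact: invM.
Qed.

End Amenability.

(** * Recurrence is zero capacity *)

Lemma small_increment (R : realType) (u : nat -> R) (C e : R) : 0 < e ->
  (forall n, u n <= C) -> exists n, u n.+1 - u n <= e.
Proof.
move=> e0 uC; apply: contrapT => /forallNP big.
have u_ge n : u 0%N + n%:R * e <= u n.
  elim: n => [|n IH]; first by rewrite mul0r addr0.
  have /negP := big n; rewrite -ltNge -natr1; lra.
have [n _ /(_ n (leqnn n)) /= nC] := nbhs_infty_ger ((C + 1 - u 0%N) / e).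
have := u_ge n; have := uC n; move: nC; rewrite ler_pdivrMr //; lra.
Qed.

Section Walks.
Variables (R : realType) (X : metricType R) (r : R).
Hypotheses (bgX : bounded_geometry X) (r0 : 0 < r).
Implicit Types (f g : X -> R) (A : {fset X}) (x y : X).

Definition nball x : {fset X} := fset_set (cball x r).

Lemma in_nball x y : (y \in nball x) = (mdist x y <= r).
Proof.
rewrite in_fset_set; first by apply/idP/idP => [/set_mem|/mem_set].
by have [N /(_ x)/card_le_finite] := bgX r0; apply.
Qed.

Lemma nball_sym x y : (y \in nball x) = (x \in nball y).
Proof. by rewrite !in_nball metric_sym. Qed.

Definition deg x : R := #|` nball x|%:R.

Lemma deg_gt0 x : 0 < deg x.
Proof.
rewrite ltr0n cardfs_gt0; apply/fset0Pn; exists x.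
by rewrite in_nball mdistxx ltW.
Qed.

Definition avg f x : R := (deg x)^-1 * \sum_(y <- nball x) f y.

Lemma deg_sub_avg f x :
  deg x * (f x - avg f x) = \sum_(y <- nball x) (f x - f y).
Proof.
rewrite mulrBr mulrA divff ?gt_eqF ?deg_gt0 // mul1r sumrB.
by rewrite big_const_seq count_predT iter_addr_0 mulr_natl.
Qed.

Lemma avg_le f g x : (forall y, f y <= g y) -> avg f x <= avg g x.
Proof.
by move=> fg; rewrite ler_wpM2l ?invr_ge0 ?ler0n //; apply: ler_sum.
Qed.

Lemma avg_cst (a : R) x : avg (fun=> a) x = a.
Proof.
rewrite /avg big_const_seq count_predT iter_addr_0 -mulr_natl mulrA.
by rewrite mulVf ?mul1r // gt_eqF ?deg_gt0.
Qed.

Definition energy_form A f g : R :=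
  \sum_(x <- A) \sum_(y <- A | mdist x y <= r) (f x - f y) * (g x - g y).

(** Summation by parts: exchange the two indices in the half of the sum that
  carries f y. *)
Lemma energy_form_parts A f g : energy_form A f g =
  2 * \sum_(x <- A) f x * \sum_(y <- A | mdist x y <= r) (g x - g y).
Proof.
have -> : energy_form A f g =
    \sum_(x <- A) \sum_(y <- A | mdist x y <= r) f x * (g x - g y)
    + \sum_(x <- A) \sum_(y <- A | mdist x y <= r) f y * (g y - g x).
  rewrite -big_split; apply: eq_bigr => x _; rewrite -big_split.
  by apply: eq_bigr => y _ /=; ring.
have -> : \sum_(x <- A) \sum_(y <- A | mdist x y <= r) f y * (g y - g x)
    = \sum_(x <- A) \sum_(y <- A | mdist x y <= r) f x * (g x - g y).
  rewrite (exchange_big_dep xpredT) //=; apply: eq_bigr => y _.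
  by apply: eq_bigl => x; rewrite metric_sym.
rewrite mulr_sumr -big_split; apply: eq_bigr => x _ /=.
by rewrite -mulr_sumr; ring.
Qed.

Definition fset_nbhd A : {fset X} :=
  (A `|` [fset y in flatten [seq enum_fset (nball x) | x <- A]])%fset.

Lemma mem_fset_nbhd A x y : x \in A -> y \in nball x -> y \in fset_nbhd A.
Proof.
move=> xA yx; rewrite !inE; apply/orP; right.
by apply/flattenP; exists (enum_fset (nball x)) => //; apply/mapP; exists x.
Qed.

(** Green's formula against the Laplacian of the walk.  It only involves g near
  the support of f, as soon as A is large enough to contain the balls centred in
  that support. *)
Lemma energy_form_local A0 A f g : (forall x, x \notin A0 -> f x = 0) ->
  (fset_nbhd A0 `<=` A)%fset ->
  energy_form A f g = 2 * \sum_(x <- A0) f x * (deg x * (g x - avg g x)).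
Proof.
move=> fA0 A0A; rewrite energy_form_parts; congr (_ * _).
have subA : (A0 `<=` A)%fset by apply: fsubset_trans A0A; exact: fsubsetUl.
rewrite (big_fset_incl _ subA) /=; last by move=> x _ /fA0 ->; rewrite mul0r.
apply: eq_big_seq => x _.
have [xA0|/fA0 ->] := boolP (x \in A0); last by rewrite !mul0r.
rewrite deg_sub_avg; congr (_ * _).
rewrite -big_filter; apply: perm_big.
apply: uniq_perm; rewrite ?filter_uniq ?fset_uniq // => y.
rewrite mem_filter -in_nball.
apply/andP/idP => [[]//|yx]; split=> //.
by apply: (fsubsetP A0A); exact: mem_fset_nbhd yx.
Qed.

Lemma energyE A f : energy r A f = energy_form A f f.
Proof. by []. Qed.

Lemma energy_sub A A' f : (A `<=` A')%fset -> energy r A f <= energy r A' f.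
Proof.
move=> /fsubsetP AA'.
apply: (le_trans (y := \sum_(x <- A) \sum_(y <- A' | mdist x y <= r)
    (f x - f y) ^+ 2)).
  apply: ler_sum => x _; rewrite big_mkcond [leRHS]big_mkcond.
  apply: ler_sum_uniq_sub => //= y _; by case: ifP => // _; exact: sqr_ge0.
apply: ler_sum_uniq_sub => // x _.
by apply: sumr_ge0 => y _; exact: sqr_ge0.
Qed.

Lemma energy_form_le A f g :
  2 * energy_form A f g <= energy r A f + energy r A g.
Proof.
rewrite mulr_sumr -big_split; apply: ler_sum => x _ /=.
rewrite mulr_sumr -big_split; apply: ler_sum => y _ /=.
by rewrite -subr_ge0; have := sqr_ge0 ((f x - f y) - (g x - g y)); lra.
Qed.

Variable x0 : X.

(** The probability that the walk started at x is at x0 at one of the times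
  0, ..., k.  Bounding the time keeps the support finite and makes the function
  harmonic outside x0 up to the nonnegative defect hit k.+1 - hit k. *)
Fixpoint hit k x : R :=
  if x == x0 then 1 else if k is k'.+1 then avg (hit k') x else 0.

Lemma hitx0 k : hit k x0 = 1.
Proof. by case: k => [|k] /=; rewrite eqxx. Qed.

Lemma hitS k x : x != x0 -> hit k.+1 x = avg (hit k) x.
Proof. by move=> /negbTE /= ->. Qed.

Lemma hit01 k x : 0 <= hit k x <= 1.
Proof.
elim: k x => [|k IH] x /=; case: eqP => _; rewrite ?lexx ?ler01 //.
apply/andP; split.
  by rewrite -(avg_cst 0 x) avg_le // => y; case/andP: (IH y).
by rewrite -[leRHS](avg_cst 1 x) avg_le // => y; case/andP: (IH y).
Qed.

Lemma hit_le k x : hit k x <= hit k.+1 x.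
Proof.
elim: k x => [|k IH] x.
  by have /andP[+ _] := hit01 1 x; rewrite /=; case: eqP.
have [->|xx0] := eqVneq x x0; first by rewrite !hitx0.
by rewrite !hitS // avg_le.
Qed.

Lemma hit_support k : exists A, forall x, x \notin A -> hit k x = 0.
Proof.
elim: k => [|k [A IH]].
  by exists [fset x0]%fset => x; rewrite inE /= => /negbTE ->.
exists (x0 |` fset_nbhd A)%fset => x.
rewrite in_fset1U negb_or => /andP[xx0 xA].
rewrite hitS // /avg big_seq big1 ?mulr0 // => y yx.
apply: IH; apply: contra xA => yA.
by apply: mem_fset_nbhd yA _; rewrite nball_sym.
Qed.

(** By Green's formula the energy is the sum of hit k x times the Laplacian at
  x.  Away from x0 the Laplacian is hit k x - hit k.+1 x <= 0, so only x0
  contributes, and there 1 - avg (hit k) x0 is the probability of not returning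
  to x0 within k + 1 steps. *)
Lemma energy_hit_le A k :
  energy r A (hit k) <= 2 * (deg x0 * (1 - avg (hit k) x0)).
Proof.
have [A0 hA0] := hit_support k.
apply: (le_trans (energy_sub _ (fsubsetUl A (fset_nbhd A0)))).
rewrite energyE (energy_form_local _ hA0) ?fsubsetUr // ler_pM2l //.
have x0A0 : x0 \in A0.
  by apply/negPn/negP => /hA0/eqP; rewrite hitx0 oner_eq0.
rewrite (big_rem x0) //= hitx0 mul1r gerDl big_seq sumr_le0 // => x.
rewrite mem_rem_uniq ?fset_uniq // inE => /andP[xx0 _].
rewrite mulr_ge0_le0 //; first by case/andP: (hit01 k x).
rewrite pmulr_rle0 ?deg_gt0 // subr_le0 -hitS //; exact: hit_le.
Qed.

(** The trajectories of the walk from x that make at most k steps and avoid x0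
  (the starting point excepted). *)
Fixpoint return_words k x : seq (seq X) :=
  [::] :: if k is k'.+1 then
    [seq y :: w | y <- rem x0 (enum_fset (nball x)), w <- return_words k' y]
  else [::].

Lemma return_words_uniq k x : uniq (return_words k x).
Proof.
elim: k x => [|k IH] x //=; apply/andP; split.
  by apply/negP => /allpairsPdep[y [w []]].
apply: allpairs_uniq_dep => [||[y w] [y' w'] _ _ [-> ->]] //.
by rewrite rem_uniq ?fset_uniq.
Qed.

Lemma return_words_avoid k x w : w \in return_words k x -> x0 \notin w.
Proof.
elim: k x w => [|k IH] x w /=; rewrite inE; first by move=> /eqP ->.
move=> /orP[/eqP -> //|/allpairsPdep[y [v [yx vy ->]]]].
rewrite inE negb_or (IH _ _ vy) andbT.
by move: yx; rewrite mem_rem_uniq ?fset_uniq // inE eq_sym => /andP[].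
Qed.

Lemma step_probE x y : step_prob r x y = (y \in nball x)%:R / deg x.
Proof. by rewrite /step_prob in_nball; case: ifP; rewrite ?mul1r ?mul0r. Qed.

Lemma walk_prob_ge0 x w : 0 <= walk_prob r x w.
Proof.
elim: w x => [|y w IH] x //=.
by rewrite mulr_ge0 // step_probE divr_ge0 ?ler0n // ltW ?deg_gt0.
Qed.

Lemma mem_return_words k x w : x0 \notin w -> (size w <= k)%N ->
  walk_prob r x (rcons w x0) != 0 -> w \in return_words k x.
Proof.
elim: k x w => [|k IH] x [|y w] //=.
rewrite !inE negb_or => /andP[x0y x0w] wk.
rewrite mulf_eq0 negb_or => /andP[+ wp] /=.
rewrite step_probE; have [yx _|] := boolP (y \in nball x); last first.
  by rewrite mul0r eqxx.
apply/allpairsPdep; exists y, w; split=> //; last exact: IH.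
by rewrite mem_rem_uniq ?fset_uniq // inE eq_sym x0y.
Qed.

(** Both sides are the probability that the walk from x is at x0 at one of the
  times 1, ..., k + 1. *)
Lemma sum_return_words k x :
  \sum_(w <- return_words k x) walk_prob r x (rcons w x0) = avg (hit k) x.
Proof.
have avgE (h : X -> R) z : h x0 = 1 -> avg h z =
    step_prob r z x0 +
    \sum_(y <- rem x0 (enum_fset (nball z))) step_prob r z y * h y.
  move=> h1; rewrite /avg step_probE.
  have -> : \sum_(y <- rem x0 (enum_fset (nball z))) step_prob r z y * h y =
      (deg z)^-1 * \sum_(y <- rem x0 (enum_fset (nball z))) h y.
    rewrite mulr_sumr; apply: eq_big_seq => y /mem_rem yx.
    by rewrite step_probE yx mul1r.
  have [xx|xx] := boolP (x0 \in nball z).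
    by rewrite (big_rem x0) //= h1 mulrDr mulr1 mul1r.
  by rewrite mul0r add0r rem_id.
elim: k x => [|k IH] x.
  rewrite big_seq1 [RHS]avgE ?hitx0 // [walk_prob _ _ _]/= mulr1.
  rewrite [X in _ + X]big_seq [X in _ + X]big1 ?addr0 // => y.
  rewrite mem_rem_uniq ?fset_uniq // inE => /andP[/negbTE /= -> _].
  by rewrite mulr0.
rewrite [return_words _ _]/= big_cons [walk_prob _ _ _]/= mulr1.
rewrite [RHS]avgE ?hitx0 //; congr (_ + _).
rewrite big_allpairs_dep; apply: eq_big_seq => y.
rewrite mem_rem_uniq ?fset_uniq // inE => /andP[yx0 _].
by rewrite hitS // -IH mulr_sumr.
Qed.

Lemma avg_hit_le_return_prob k : ((avg (hit k) x0)%:E <= return_prob r x0)%E.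
Proof.
rewrite -sum_return_words -sumEFin; apply: ereal_sup_ubound.
exists [set` return_words k x0].
  by split=> [|w /= /return_words_avoid]; first exact: finite_seq.
by rewrite -fsbig_seq ?return_words_uniq.
Qed.

Lemma return_prob_le (c : R) :
  (forall k, avg (hit k) x0 <= c) -> (return_prob r x0 <= c%:E)%E.
Proof.
move=> hc; apply: ge_ereal_sup => _ [A [finA Ax0] <-].
rewrite fsbig_finite // sumEFin lee_fin.
pose k := \max_(w <- fset_set A) size w.
apply: le_trans (hc k); rewrite -sum_return_words.
have Ak w : w \in fset_set A -> (x0 \notin w) && (size w <= k)%N.
  move=> wA; rewrite /k (big_rem w) //= leq_maxl andbT; apply: Ax0.
  by move: wA; rewrite in_fset_set // => /set_mem.
rewrite (bigID (fun w => walk_prob r x0 (rcons w x0) != 0)) /=.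
rewrite [X in _ + X]big1 ?addr0 => [|w /negbNE/eqP //].
rewrite -big_filter; apply: ler_sum_uniq_sub.
- by rewrite filter_uniq ?fset_uniq.
- exact: return_words_uniq.
- move=> w; rewrite mem_filter => /andP[wp /Ak/andP[x0w wk]].
  exact: mem_return_words.
- by move=> w _; exact: walk_prob_ge0.
Qed.

(** The functions hit k witness it, by [energy_hit_le]: the probability of not
  returning within k + 1 steps tends to 0. *)
Lemma null_capacity_of_return :
  ~ (return_prob r x0 < 1)%E -> null_capacity r x0.
Proof.
move=> ret1 e e0; pose d := e / (2 * deg x0).
have d0 : 0 < d by rewrite divr_gt0 // mulr_gt0 // deg_gt0.
have [k hk] : exists k, 1 - d < avg (hit k) x0.
  apply: contrapT => /forallNP hd; apply: ret1.
  apply: (@le_lt_trans _ _ (1 - d)%:E); last by rewrite lte_fin gtrBl.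
  by apply: return_prob_le => k; rewrite leNgt; apply/negP.
exists (hit k); split; [exact: hit_support|exact: hit01|exact: hitx0|].
move=> A; apply: (le_trans (energy_hit_le A k)).
have -> : e = 2 * (deg x0 * d).
  by rewrite /d; field; rewrite gt_eqF ?deg_gt0.
by rewrite ler_pM2l // ler_pM2l ?deg_gt0 //; lra.
Qed.

(** Dirichlet's principle.  If the walk escapes with positive probability, let D
  be deg x0 times that probability.  For f supported in a finite set with
  f x0 = 1, the mutual energy of f and hit k tends to 2 D as k grows, and so
  does an upper bound of the energy of hit k; by 2 E(f, h) <= E(f) + E(h) the
  energy of f cannot be smaller than 2 D.  Taking k with a small increment of
  hit k on the support of f replaces the limit, and an f of energy at most D / 2
  gives the contradiction. *)
Lemma return_of_null_capacity :
  null_capacity r x0 -> ~ (return_prob r x0 < 1)%E.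
Proof.
move=> cap0 ret1.
have ret_fin : return_prob r x0 \is a fin_num.
  rewrite ge0_fin_numE; first by rewrite (lt_trans ret1) // ltry.
  by apply: esum_ge0 => w _; rewrite lee_fin walk_prob_ge0.
pose c := fine (return_prob r x0).
have c1 : c < 1 by rewrite -lte_fin fineK.
have hc k : avg (hit k) x0 <= c.
  by rewrite -lee_fin fineK // avg_hit_le_return_prob.
pose D := deg x0 * (1 - c).
have D0 : 0 < D by rewrite mulr_gt0 ?deg_gt0 // subr_gt0.
have [f [[A fA] f01 fx0 fE]] := cap0 (D / 2) (divr_gt0 D0 (ltr0Sn _ 1)).
pose u k := \sum_(x <- rem x0 (enum_fset A)) f x * deg x * hit k x.
have [|k uk] := @small_increment R u
    (\sum_(x <- rem x0 (enum_fset A)) f x * deg x)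
    (D / 4) (divr_gt0 D0 (ltr0Sn _ 3)).
  move=> k; apply: ler_sum => x _.
  have /andP[fx _] := f01 x; have /andP[_ hx] := hit01 k x.
  by rewrite ler_piMr // mulr_ge0 // ltW ?deg_gt0.
have x0A : x0 \in A.
  by apply/negPn/negP => /fA/eqP; rewrite fx0 oner_eq0.
have := energy_form_le (fset_nbhd A) f (hit k).
have := energy_hit_le (fset_nbhd A) k; have := fE (fset_nbhd A).
rewrite (energy_form_local _ fA) // (big_rem x0) //= fx0 mul1r hitx0.
have -> : \sum_(x <- rem x0 (enum_fset A))
      f x * (deg x * (hit k x - avg (hit k) x))
    = u k - u k.+1.
  rewrite /u -sumrB; apply: eq_big_seq => x.
  rewrite mem_rem_uniq ?fset_uniq // inE => /andP[xx0 _].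
  by rewrite (hitS _ xx0); ring.
have : D <= deg x0 * (1 - avg (hit k) x0).
  by rewrite ler_pM2l ?deg_gt0 // lerB.
by move: uk; set v := deg x0 * (1 - avg _ _); lra.
Qed.

End Walks.

(** * Spaces over the plane have zero capacity *)

Section HarmonicTestFunction.
Variable R : realType.
Implicit Types (N n m L : nat).

Definition harmonic_weight N n : R := if (n < N)%N then n.+1%:R^-1 else 0.

Definition harmonic_tail N n : R := \sum_(n <= i < N) i.+1%:R^-1.

Lemma harmonic_tailS N n :
  harmonic_tail N n = harmonic_weight N n + harmonic_tail N n.+1.
Proof.
rewrite /harmonic_tail /harmonic_weight; case: ltnP => nN.
  by rewrite big_ltn.
by rewrite !big_geq ?addr0 // ltnW.
Qed.

Lemma harmonic_weight_ge0 N n : 0 <= harmonic_weight N n.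
Proof. by rewrite /harmonic_weight; case: ifP. Qed.

Lemma harmonic_weight_le N n m :
  (n <= m)%N -> harmonic_weight N m <= harmonic_weight N n.
Proof.
rewrite /harmonic_weight => nm; case: ltnP => [mN|_].
  by rewrite (leq_ltn_trans nm mN) lef_pV2 ?posrE ?ltr0n // ler_nat.
by case: ifP.
Qed.

Lemma harmonic_tail_diff N n k :
  0 <= harmonic_tail N n - harmonic_tail N (n + k)
    <= k%:R * harmonic_weight N n.
Proof.
elim: k => [|k IH]; first by rewrite addn0 subrr mul0r lexx.
move: IH; rewrite (harmonic_tailS N (n + k)) addnS -natr1.
have := harmonic_weight_ge0 N (n + k).
have := harmonic_weight_le N (leq_addr k n); lra.
Qed.

Lemma harmonic_tail_sqr_diff N n m L : (n <= m + L)%N -> (m <= n + L)%N ->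
  (harmonic_tail N n - harmonic_tail N m) ^+ 2 <=
  L%:R ^+ 2 * (harmonic_weight N n ^+ 2 + harmonic_weight N m ^+ 2).
Proof.
wlog nm : n m / (n <= m)%N.
  move=> le_nm nL mL; case: (leqP n m) => [|/ltnW] mn; first exact: le_nm.
  by rewrite -sqrrN opprB [X in _ * X]addrC le_nm.
move=> _ mL; have /andP[] := harmonic_tail_diff N n (m - n); rewrite subnKC //.
have : (m - n)%:R <= L%:R :> R by rewrite ler_nat leq_subLR.
have := harmonic_weight_ge0 N n; have := sqr_ge0 (harmonic_weight N m).
move: (harmonic_weight N n) (harmonic_weight N m) (harmonic_tail _ _ - _).
move=> a b d b0 a0 mnL d0 dle.
have dL : d <= L%:R * a by rewrite (le_trans dle) // ler_wpM2r.
rewrite mulrDr -exprMn; apply: (@le_trans _ _ ((L%:R * a) ^+ 2)).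
  by rewrite ler_pXn2r ?nnegrE // mulr_ge0.
by rewrite lerDl mulr_ge0 ?sqr_ge0.
Qed.

Lemma harmonic_tail_unbounded (M : R) : exists N, M < harmonic_tail N 0.
Proof.
apply: contrapT => /forallNP Mub; apply: (@dvg_harmonic R).
apply: nondecreasing_is_cvgn.
  by apply: nondecreasing_series => n _ _; rewrite invr_ge0.
by exists M => _ [n _ <-]; rewrite leNgt; apply/negP; exact: Mub.
Qed.

End HarmonicTestFunction.

Definition supnorm (v : int * int) : nat := maxn `|v.1|%N `|v.2|%N.

(** A list that covers the sphere of radius j of the sup norm: two vertical and
  two horizontal sides, with the corners repeated. *)
Definition square_sphere (j : nat) : seq (int * int) :=
  let side := [seq i%:Z - j%:Z | i <- iota 0 (j.*2).+1] in
  let ends := [:: j%:Z; - j%:Z] in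
  [seq (a, b) | a <- ends, b <- side] ++ [seq (a, b) | a <- side, b <- ends].

Lemma size_square_sphere j : (size (square_sphere j) <= 8 * j.+1)%N.
Proof. by rewrite size_cat !size_allpairs !size_map !size_iota /=; lia. Qed.

Lemma mem_square_sphere v : v \in square_sphere (supnorm v).
Proof.
case: v => a b; rewrite /supnorm /=; set j := maxn _ _.
have mem_side (c : int) : (`|c| <= j)%N ->
    c \in [seq i%:Z - j%:Z | i <- iota 0 (j.*2).+1].
  move=> cj; apply/mapP; exists (absz (c + j%:Z)); last by lia.
  by rewrite mem_iota; lia.
have mem_ends (c : int) : `|c|%N = j -> c \in [:: j%:Z; - j%:Z].
  by rewrite !inE => <-; lia.
rewrite mem_cat; apply/orP.
have [ab|ba] := leqP `|b|%N `|a|%N; [left|right].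
  apply/allpairsP; exists (a, b); split=> //.
    by apply: mem_ends; apply/esym/maxn_idPl.
  by apply: mem_side; exact: leq_maxr.
apply/allpairsP; exists (a, b); split=> //.
  by apply: mem_side; exact: leq_maxl.
by apply: mem_ends; apply/esym/maxn_idPr; exact: ltnW.
Qed.

Section Planar.
Variables (R : realType) (X : metricType R).
Hypothesis bgX : bounded_geometry X.

(** What recurrence uses of a coarse embedding in Z^2: control of expansion and
  uniformly bounded fibres. *)
Definition planar_map (q : X -> int * int) : Prop :=
  (forall r : R, exists L, forall x y, mdist x y <= r ->
    (supnorm (q x - q y)%R <= L)%N) /\
  (exists C, forall v (s : seq X), uniq s -> (forall x, x \in s -> q x = v) ->
    (size s <= C)%N).

Lemma bounded_geometry_seq (r : R) : 0 < r -> exists K, forall x (s : seq X),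
  uniq s -> (forall y, y \in s -> mdist x y <= r) -> (size s <= K)%N.
Proof.
move=> r0; have [K XK] := bgX r0; exists K => x s us sr.
have finB : finite_set (cball x r).
  exact: card_le_finite (XK x) (finite_II K).
apply: leq_trans (geq_card_fset_set (XK x)); apply: uniq_leq_size => // y ys.
by rewrite in_fset_set // mem_set //; exact: sr.
Qed.

Variable q : X -> int * int.
Hypothesis q_planar : planar_map q.
Variable x0 : X.

Let radius x : nat := supnorm (q x - q x0).

Lemma sphere_card : exists C, forall j (s : seq X), uniq s ->
  (count (fun x => radius x == j) s <= C * (8 * j.+1))%N.
Proof.
have [_ [C qC]] := q_planar; exists C => j s us.
have mono : (count (fun x => radius x == j) s <=
    \sum_(v <- square_sphere j) count (fun x => q x - q x0 == v)%R s)%N.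
  rewrite -sum1_count big_mkcond /=.
  under [X in (_ <= X)%N]eq_bigr do rewrite -sum1_count big_mkcond.
  rewrite exchange_big; apply: leq_sum => x _; case: eqP => // xj.
  have := mem_square_sphere (q x - q x0); rewrite -/(radius x) xj => xs.
  by rewrite (big_rem _ xs) /= eqxx.
apply: (leq_trans mono).
apply: (@leq_trans (\sum_(v <- square_sphere j) C)); last first.
  rewrite big_const_seq count_predT iter_addn_0 leq_mul2l size_square_sphere.
  by rewrite orbT.
apply: leq_sum => v _; rewrite -size_filter; apply: (qC (v + q x0)%R).
  exact: filter_uniq.
by move=> x; rewrite mem_filter => /andP[/eqP <- _]; rewrite subrK.
Qed.

(** The number of points of radius j is at most a constant times j + 1, and each
  contributes 1/(j+1)^2, so that a harmonic sum bounds the total. *)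
Lemma sum_sqr_weight_le : exists C : nat, forall N (s : seq X), uniq s ->
  \sum_(x <- s) harmonic_weight R N (radius x) ^+ 2 <=
  C%:R * harmonic_tail R N 0.
Proof.
have [C sC] := sphere_card; exists (C * 8)%N => N s us.
have -> : \sum_(x <- s) harmonic_weight R N (radius x) ^+ 2 =
    \sum_(0 <= j < N) (count (fun x => radius x == j) s)%:R * j.+1%:R ^- 2 :> R.
  under [RHS]eq_bigr do rewrite -sum1_count natr_sum big_mkcond /= mulr_suml.
  rewrite exchange_big; apply: eq_bigr => x _ /=.
  rewrite /harmonic_weight; case: ltnP => xN.
    rewrite (bigD1_seq (radius x)) ?iota_uniq ?mem_index_iota //= eqxx mul1r.
    rewrite big1 ?addr0 ?exprVn // => j jx.
    by rewrite eq_sym (negbTE jx) mul0r.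
  rewrite expr0n big_nat big1 // => j /andP[_ jN].
  by rewrite gtn_eqF ?mul0r // (leq_trans jN).
rewrite /harmonic_tail mulr_sumr; apply: ler_sum => j _.
have j0 : 0 < j.+1%:R :> R by rewrite ltr0n.
have -> : (C * 8)%:R * j.+1%:R^-1 = (C * (8 * j.+1))%:R * j.+1%:R ^- 2 :> R.
  by rewrite !natrM; move: (_.+1%:R) j0 => t t0; field; rewrite gt_eqF.
by rewrite ler_wpM2r ?invr_ge0 ?exprn_ge0 ?ler0n // ler_nat sC.
Qed.

Lemma disc_finite N :
  exists A : {fset X}, forall x, x \notin A -> (N <= radius x)%N.
Proof.
suff finN : finite_set [set x | (radius x < N)%N].
  exists (fset_set [set x | (radius x < N)%N]) => x.
  by rewrite in_fset_set // leqNgt; apply: contra => xN; rewrite mem_set.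
apply: contrapT => /(infinite_set_fset _) infN.
have [C sC] := sphere_card.
have [B BN] := infN (\sum_(j < N) C * (8 * j.+1)).+1.
rewrite ltnNge => /negP; apply.
apply: (@leq_trans (\sum_(j < N) count (fun x => radius x == j) B)); last first.
  by apply: leq_sum => j _; rewrite sC ?fset_uniq.
under eq_bigr do rewrite -sum1_count big_mkcond.
rewrite exchange_big -sum1_size big_seq [X in (_ <= X)%N]big_seq.
apply: leq_sum => x /BN /= xN.
by rewrite (bigD1 (Ordinal xN)) //= eqxx.
Qed.

(** The test function is the harmonic tail at the radius, normalized by the full
  harmonic sum H.  An edge moves the radius by at most L, so that it
  contributes at most (L/H)^2 times the squared weights at its ends; each point
  is in at most K edges, and the squared weights add up to at most C H.  The
  energy is thus at most 2 L^2 K C / H, which is small because the harmonic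
  series diverges. *)
Lemma planar_null_capacity (r : R) : 0 < r -> null_capacity r x0.
Proof.
move=> r0 e e0.
have [L qL] := q_planar.1 r.
have [K XK] := bounded_geometry_seq r0.
have [C sC] := sum_sqr_weight_le.
have [N] := harmonic_tail_unbounded (L%:R ^+ 2 * (2 * K%:R * C%:R) / e).
set H := harmonic_tail R N 0 => HN.
have H0 : 0 < H.
  by apply: le_lt_trans HN; rewrite divr_ge0 ?mulr_ge0 ?sqr_ge0 // ltW.
pose S x := harmonic_tail R N (radius x).
pose w x := harmonic_weight R N (radius x).
exists (fun x => S x / H); split.
- have [A AN] := disc_finite N; exists A => x /AN xN.
  by rewrite /S /harmonic_tail big_geq // mul0r.
- move=> x; have := harmonic_tail_diff R N 0 (radius x).
  rewrite add0n => /andP[SH _].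
  apply/andP; split; first by rewrite divr_ge0 ?(ltW H0) // sumr_ge0.
  by rewrite ler_pdivrMr // mul1r -subr_ge0.
- by rewrite /S /radius subrr divff ?gt_eqF.
move=> A; rewrite /energy.
have bound x y : mdist x y <= r ->
    (S x / H - S y / H) ^+ 2 <= L%:R ^+ 2 / H ^+ 2 * (w x ^+ 2 + w y ^+ 2).
  move=> xy; rewrite -mulrBl exprMn exprVn [leRHS]mulrAC.
  rewrite ler_wpM2r ?invr_ge0 ?sqr_ge0 //.
  have tri u v : (supnorm (u + v)%R <= supnorm u + supnorm v)%N.
    by rewrite /supnorm /=; lia.
  have supN u : supnorm (- u)%R = supnorm u by rewrite /supnorm /= !abszN.
  apply: harmonic_tail_sqr_diff; rewrite /radius.
    have := tri (q y - q x0) (q x - q y); rewrite addrC subrKA.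
    by move/leq_trans; apply; rewrite leq_add2l qL.
  have := tri (q x - q x0) (q y - q x); rewrite addrC subrKA.
  by move/leq_trans; apply; rewrite leq_add2l -supN opprB qL.
have degK x : (count (fun y => mdist x y <= r)%R A <= K)%N.
  rewrite -size_filter; apply: (XK x); first by rewrite filter_uniq ?fset_uniq.
  by move=> y; rewrite mem_filter => /andP[].
have half : \sum_(x <- A) \sum_(y <- A | mdist x y <= r) w x ^+ 2 <=
    K%:R * (C%:R * H).
  apply: (@le_trans _ _ (\sum_(x <- A) K%:R * w x ^+ 2)).
    apply: ler_sum => x _; rewrite big_const_seq iter_addr_0 -[leLHS]mulr_natl.
    by rewrite ler_wpM2r ?sqr_ge0 // ler_nat.
  by rewrite -mulr_sumr ler_wpM2l // sC ?fset_uniq.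
apply: (@le_trans _ _ (L%:R ^+ 2 / H ^+ 2 * (2 * (K%:R * (C%:R * H))))).
  apply: (@le_trans _ _ (\sum_(x <- A) \sum_(y <- A | mdist x y <= r)
      L%:R ^+ 2 / H ^+ 2 * (w x ^+ 2 + w y ^+ 2))).
    by apply: ler_sum => x _; apply: ler_sum => y; exact: bound.
  under eq_bigr do rewrite -mulr_sumr big_split.
  rewrite -mulr_sumr ler_wpM2l ?divr_ge0 ?sqr_ge0 //.
  rewrite big_split mulr_natl mulr2n lerD //.
  rewrite (exchange_big_dep xpredT) //= (le_trans _ half) //.
  by under eq_bigr do under eq_bigl do rewrite metric_sym.
rewrite ltr_pdivrMr // in HN.
have -> : L%:R ^+ 2 / H ^+ 2 * (2 * (K%:R * (C%:R * H))) =
    L%:R ^+ 2 * (2 * K%:R * C%:R) / H.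
  by field; rewrite gt_eqF.
by rewrite ler_pdivrMr // [e * _]mulrC ltW.
Qed.

End Planar.

(** * Word metrics and coarse embeddings *)

Section WordSpaces.
Variables (R : realType) (V : zmodType) (S : seq V) (gS : generates S).
Let G : cgraph := cayley_graph gS.

(** The letter 0 is added to the alphabet so that word_ball n contains the sums
  of fewer than n letters. *)
Fixpoint word_ball (n : nat) : seq V :=
  if n is n'.+1 then
    [seq e + u | e <- 0 :: S ++ map -%R S, u <- word_ball n']
  else [:: 0].

Lemma word_ballD n (e u : V) :
  e \in 0 :: S ++ map -%R S -> u \in word_ball n -> e + u \in word_ball n.+1.
Proof. exact: (allpairs_f +%R). Qed.

Lemma word_ball_path (x : G) (p : seq G) n : path (@adj G) x p ->
  (size p <= n)%N -> (last x p : V) - x \in word_ball n.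
Proof.
elim: n x p => [|n IH] x [|y p]; rewrite ?subrr //.
- by move=> _ _; rewrite inE.
- move=> _ _; have -> : 0 = 0 + 0 :> V by rewrite addr0.
  rewrite word_ballD ?mem_head //.
  by have := IH x [::] isT (leq0n n); rewrite subrr.
rewrite [path _ _ _]/= => /andP[xy yp] pn.
have -> : (last x (y :: p) : V) - x = ((y : V) - x) + ((last y p : V) - y).
  by rewrite [RHS]addrC subrKA.
apply: word_ballD; last exact: IH.
rewrite inE mem_cat; apply/orP; right; apply/orP.
case/orP: xy => [|xyS]; [by left|right].
by apply/mapP; exists ((x : V) - y) => //; rewrite opprB.
Qed.

Lemma word_ball_mdist (r : R) : exists n, forall x y : word_space R gS,
  mdist x y <= r -> (y : V) - x \in word_ball n.
Proof.
have [n _ /(_ n (leqnn n)) /= rn] := nbhs_infty_ger r.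
exists n => x y xy; have [p [xp py pn]] := @gdistP G x y; rewrite -py.
apply: word_ball_path xp _; rewrite pn -(ler_nat R).
exact: le_trans xy rn.
Qed.

Lemma bounded_geometry_word_space : bounded_geometry (word_space R gS).
Proof.
move=> r _; have [n rn] := word_ball_mdist r; exists (size (word_ball n)) => x.
pose s : seq (word_space R gS) := [seq (x : V) + u | u <- word_ball n].
have sub : cball x r `<=` [set` s].
  move=> y /= /rn yx; apply/mapP; exists ((y : V) - x) => //.
  by rewrite addrC subrK.
apply: (card_le_trans (subset_card_le sub)).
apply: (card_le_trans _ (card_image_le (nth x s) `I_(size (word_ball n)))).
apply: subset_card_le => y /= /(nthP x)[i ins <-].
by exists i => //; rewrite size_map in ins.
Qed.

Lemma planar_word_space (h : {additive V -> int * int}) : injective h ->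
  @planar_map R (word_space R gS) h.
Proof.
move=> h_inj; split=> [r|].
  have [n rn] := word_ball_mdist r.
  exists (\max_(u <- word_ball n) supnorm (h u)) => x y.
  rewrite metric_sym => xy; rewrite -raddfB.
  by rewrite (big_rem ((x : V) - y)) ?leq_maxl //=; exact: rn.
exists 1%N => v [|x [|y s]] //= /andP[+ _] sv.
by rewrite inE (h_inj x y) ?eqxx // !sv ?inE ?eqxx ?orbT.
Qed.

End WordSpaces.

Section CoarseEmbedding.
Variables (R : realType) (X Y : metricType R) (q : X -> Y).
Hypotheses (bgX : bounded_geometry X) (q_coarse : coarse_embedding q).

(** Two points of the same fibre of q satisfy phim (mdist x y) <= 0, which
  bounds their distance since phim tends to infinity; bounded geometry then
  bounds the fibre. *)
Lemma planar_coarse_embedding (h : Y -> int * int) :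
  planar_map h -> injective h -> planar_map (h \o q).
Proof.
have [phip [phim [phip_nd _ phim_oo q_phi]]] := q_coarse.
move=> [hL _] h_inj; split=> [r|].
  have [L hrL] := hL (phip r); exists L => x y xy; apply: hrL.
  have /andP[_ /le_trans] := q_phi x y; apply.
  by apply: phip_nd; rewrite ?mdist_ge0.
have [T [T0 phimT]] : exists T, 0 < T /\ forall t, T < t -> 0 < phim t.
  move/cvgryPgt: phim_oo => /(_ 0) [T [_ phimT]].
  exists (Num.max T 1); rewrite lt_max ltr01 orbT; split=> // t.
  by rewrite gt_max => /andP[/phimT].
have [K XK] := bounded_geometry_seq bgX T0; exists K => v [//|x s] us sv.
apply: (XK x) => // y ys; rewrite leNgt; apply/negP => /phimT.
have /andP[+ _] := q_phi x y.
have -> : q x = q y.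
  by apply: h_inj; rewrite [LHS](sv x (mem_head _ _)) [RHS](sv y ys).
by rewrite mdistxx; lra.
Qed.

End CoarseEmbedding.

(** * The theorem *)

Lemma recurrent_of_planar (R : realType) (X : metricType R)
    (q : X -> int * int) :
  bounded_geometry X -> planar_map q -> forall x0 : X, recurrent x0.
Proof.
move=> bgX qp x0 [r r0]; apply: return_of_null_capacity => //.
exact: planar_null_capacity qp _ _ r0.
Qed.

Lemma amenable_of_recurrent (R : realType) (X : metricType R) (x0 : X) :
  bounded_geometry X -> recurrent x0 -> amenable_action R (affine_action X).
Proof.
move=> bgX recX; apply: (@amenable_of_null_capacity _ _ x0) => r r0.
by apply: null_capacity_of_return => // ret1; apply: recX; exists r.
Qed.

(** Over the empty space there is one configuration, and evaluation at it is an
  invariant mean. *)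
Lemma amenable_of_empty (R : realType) (X : metricType R) :
  (X -> False) -> amenable_action R (affine_action X).
Proof.
move=> X0; pose mu0 (f : linfty R (dsum X)) : R^o := f 0.
have mu0_linear : linear mu0 by [].
pose mu : {linear linfty R (dsum X) -> R^o} :=
  HB.pack mu0 (GRing.isLinear.Build _ _ _ _ mu0 mu0_linear).
exists mu; first by apply: is_mean_of_bound => // f M; exact.
by move=> u f; congr (f _); apply: dsum_eq => x; case: (X0 x).
Qed.

Theorem theorem1p4 (R : realType) :
  ((forall X : metricType R, bounded_geometry X ->
      forall x0 : X, recurrent x0 -> amenable_action R (affine_action X))
   /\ (forall (S : seq int) (gS : generates S),
        [/\ bounded_geometry (word_space R gS),
            forall x0 : word_space R gS, recurrent x0
          & amenable_action R (affine_action (word_space R gS))])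
   /\ (forall (S : seq (int * int)) (gS : generates S),
        [/\ bounded_geometry (word_space R gS),
            forall x0 : word_space R gS, recurrent x0
          & amenable_action R (affine_action (word_space R gS))])
   /\ (forall (S : seq (int * int)) (gS : generates S) (X : metricType R),
        bounded_geometry X ->
        (exists q : X -> word_space R gS, coarse_embedding q) ->
        (forall x0 : X, recurrent x0) /\
        amenable_action R (affine_action X)))
  /\ (forall X : metricType R, bounded_geometry X ->
       (exists2 f : graph_space R binary_tree -> X,
          injective f & lipschitz_map f) ->
       ~ amenable_action R (affine_action X)).
Proof.
have word_case (V : zmodType) (h : {additive V -> int * int}) (S : seq V)
    (gS : generates S) : injective h ->
    [/\ bounded_geometry (word_space R gS),
        forall x0 : word_space R gS, recurrent x0
      & amenable_action R (affine_action (word_space R gS))].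
  move=> h_inj; have bg := @bounded_geometry_word_space R V S gS.
  have rec := recurrent_of_planar bg (@planar_word_space R V S gS h h_inj).
  by split=> //; exact: amenable_of_recurrent bg (rec (0 : V)).
split; last by move=> X _ [f f_inj f_lip]; exact: tree_not_amenable f_inj f_lip.
split; first by move=> X bgX x0; exact: amenable_of_recurrent.
split.
  pose h (n : int) : int * int := (n, 0).
  have h_add : zmod_morphism h by move=> m n; congr pair; rewrite subr0.
  pose ha : {additive int -> int * int} :=
    HB.pack h (GRing.isZmodMorphism.Build _ _ h h_add).
  by move=> S gS; apply: (word_case _ ha) => m n [].
pose id2 : {additive int * int -> int * int} := idfun.
split; first by move=> S gS; exact: (word_case _ id2).
move=> S gS X bgX [q q_coarse].
have rec : forall x0 : X, recurrent x0.
  apply: (recurrent_of_planar bgX (q := id2 \o q)).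
  by apply: planar_coarse_embedding => //; exact: planar_word_space.
split=> //; have [[x0]|X0] := pselect (inhabited X).
  exact: amenable_of_recurrent bgX (rec x0).
by apply: amenable_of_empty => x; exact: X0.
Qed.
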